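(* Let $\sigma\in M^0_{\rho,\Lambda}(\mathbb{Z}\times\mathbb{T})$. Then $T_\sigma$ is a compact operator on $\ell^2(\mathbb{Z})$ if and only if $d=0$, where $$d=\limsup_{|k|\to\infty}\Big\{\sup_{x\in[-\pi,\pi]}|\sigma(k,x)|\Big\}.$$
   Context: $\mathbb{N}_0=\{0,1,2,\dots\}$, and $\mathbb{T}=\mathbb{R}/2\pi\mathbb{Z}$ is the one-dimensional torus, identified with $[-\pi,\pi]$ with endpoints identified. For a function $a$ of $k\in\mathbb{Z}$, $\Delta_k a(k)=a(k+1)-a(k)$ and $\Delta_k^\alpha$ is its $\alpha$-th iterate. Weight function: $\Lambda:\mathbb{Z}\to(0,\infty)$ is a fixed function for which there are positive constants $\mu_0\le\mu_1$, $C_0,C_1$ with $C_0(1+|k|)^{\mu_0}\le\Lambda(k)\le C_1(1+|k|)^{\mu_1}$ for all $k\in\mathbb{Z}$. Moreover there is a real constant $\mu\ge\mu_1$ such that for all $\alpha\in\mathbb{N}_0$ and $\gamma\in\{0,1\}$ there is $C_{\alpha,\gamma}>0$ with $|k^\gamma\Delta_k^{\alpha+\gamma}\Lambda(k)|\le C_{\alpha,\gamma}\Lambda(k)^{1-\alpha/\mu}$ for all $k\in\mathbb{Z}$. Fix $\rho\in(0,1/\mu]$. Symbol class: for $m\in\mathbb{R}$, $M^m_{\rho,\Lambda}(\mathbb{Z}\times\mathbb{T})$ is the set of functions $\sigma:\mathbb{Z}\times\mathbb{T}\to\mathbb{C}$, smooth in $x\in\mathbb{T}$ for every $k\in\mathbb{Z}$,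 such that for all $\alpha,\beta\in\mathbb{N}_0$ and $\gamma\in\{0,1\}$ there is $C_{\alpha,\beta,\gamma}>0$ with $|\Delta_k^\alpha\partial_x^\beta\big(k^\gamma\Delta_k^\gamma\sigma(k,x)\big)|\le C_{\alpha,\beta,\gamma}\Lambda(k)^{m-\rho\alpha}$ for all $(k,x)\in\mathbb{Z}\times\mathbb{T}$. The pseudo-differential operator on $\mathbb{Z}$ with symbol $\sigma$ is $$T_\sigma f(k)=(2\pi)^{-1}\int_{-\pi}^{\pi}e^{ikx}\sigma(k,x)\widehat f(x)\,dx,\quad \widehat f(x)=\sum_{l\in\mathbb{Z}}f(l)e^{-ilx},\quad k\in\mathbb{Z}.$$ For $\sigma\in M^0_{\rho,\Lambda}(\mathbb{Z}\times\mathbb{T})$ it is a bounded linear operator on $\ell^2(\mathbb{Z})$. *)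

(* Defs.v *)
(* Functions on the torus are represented by 2pi-periodic functions on R. *)
From HB Require Import structures.
From mathcomp Require Import all_boot all_order all_algebra complex.
From mathcomp Require Import all_classical all_reals all_analysis.
Set Implicit Arguments.
Unset Strict Implicit.
Unset Printing Implicit Defensive.
Import Order.TTheory GRing.Theory Num.Theory.
Import numFieldNormedType.Exports.
Local Open Scope classical_set_scope.
Local Open Scope complex_scope.
Local Open Scope ring_scope.

Definition fdiff (V : zmodType) (a : int -> V) : int -> V :=
  fun k => a (k + 1) - a k.

Definition is_weight (R : realType) (Lam : int -> R) (mu : R) : Prop :=
  [/\ forall k, 0 < Lam k,
      exists mu0 mu1 C0 C1 : R,
        [/\ 0 < mu0, mu0 <= mu1, mu1 <= mu, 0 < C0 /\ 0 < C1 &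
          forall k : int,
            C0 * (1 + `|k%:~R|) `^ mu0 <= Lam k <= C1 * (1 + `|k%:~R|) `^ mu1] &
      forall (alpha gamma : nat), (gamma <= 1)%N ->
        exists2 C : R, 0 < C & forall k : int,
          `|k%:~R ^+ gamma * iter (alpha + gamma) (@fdiff R) Lam k|
            <= C * Lam k `^ (1 - alpha%:R / mu)].

Definition cabs (R : realType) (z : R[i]) : R := ComplexField.Normc.normc z.

Definition expi (R : realType) (t : R) : R[i] := cos t +i* sin t.

(* Derivatives and integrals of complex-valued functions of a real variable are
   taken componentwise. *)
Definition cderive (R : realType) (n : nat) (f : R -> R[i]) (x : R) : R[i] :=
  derive1n n (fun y => complex.Re (f y)) x +i* derive1n n (fun y => complex.Im (f y)) x.

Definition csmooth (R : realType) (f : R -> R[i]) : Prop :=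
  forall (n : nat) (x : R),
    derivable (derive1n n (fun y => complex.Re (f y))) x 1 /\
    derivable (derive1n n (fun y => complex.Im (f y))) x 1.

Definition cmeasurable (R : realType) (D : set R) (f : R -> R[i]) : Prop :=
  measurable_fun D (fun x => complex.Re (f x)) /\ measurable_fun D (fun x => complex.Im (f x)).

Definition cintegral (R : realType) (D : set R) (f : R -> R[i]) : R[i] :=
  Rintegral lebesgue_measure D (fun x => complex.Re (f x))
    +i* Rintegral lebesgue_measure D (fun x => complex.Im (f x)).

Definition symbol_class (R : realType) (Lam : int -> R) (rho m : R)
    (sigma : int -> R -> R[i]) : Prop :=
  [/\ forall k x, sigma k (x + 2 * pi) = sigma k x,
      forall k, csmooth (sigma k) &
      forall (alpha beta gamma : nat), (gamma <= 1)%N ->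
        exists2 C : R, 0 < C & forall (k : int) (x : R),
          cabs (iter alpha (@fdiff R[i])
                  (fun j => cderive beta
                     (fun y => j%:~R ^+ gamma
                               * iter gamma (@fdiff R[i]) (sigma^~ y) j) x) k)
            <= C * Lam k `^ (m - rho * alpha%:R)].

Definition l2norm (R : realType) (f : int -> R[i]) : \bar R :=
  ((\esum_(k in [set: int]) ((cabs (f k) ^+ 2)%:E)) `^ 2^-1)%E.

Definition l2 (R : realType) : set (int -> R[i]) :=
  [set f | (l2norm f < +oo)%E].

(* \sum_(-N <= l <= N) f(l) e^(-ilx), with l = j - N *)
Definition fourier_sum (R : realType) (f : int -> R[i]) (N : nat) (x : R) : R[i] :=
  \sum_(0 <= j < N.*2.+1)
     f (j%:Z - N%:Z) * expi (- ((j%:Z - N%:Z)%:~R * x)).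

(* For f in l^2(Z) the series \sum_l f(l) e^(-ilx) is understood, as usual, in
   the sense of convergence in L^2(-pi, pi). *)
Definition is_fourier_transform (R : realType) (f : int -> R[i]) (g : R -> R[i]) :
    Prop :=
  [/\ cmeasurable `[- pi, pi]%classic g,
      (\int[lebesgue_measure]_(x in `[(- pi)%R, pi]) ((cabs (g x) ^+ 2)%:E)
         < +oo)%E &
      (fun N : nat => \int[lebesgue_measure]_(x in `[(- pi)%R, pi])
         ((cabs (g x - fourier_sum f N x) ^+ 2)%:E))%E @ \oo --> 0%E].

(* A representative of the L^2 class determined by the previous predicate. *)
Definition fourier_transform (R : realType) (f : int -> R[i]) : R -> R[i] :=
  xget (fun=> 0) [set g | is_fourier_transform f g].

Definition pseudo_diff (R : realType) (sigma : int -> R -> R[i])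
    (f : int -> R[i]) : int -> R[i] :=
  fun k => ((2 * pi)^-1)%:C *
    cintegral `[- pi, pi]%classic
      (fun x => expi (k%:~R * x) * sigma k x * fourier_transform f x).

Definition compact_operator_l2 (R : realType)
    (T : (int -> R[i]) -> (int -> R[i])) : Prop :=
  [/\ forall f, l2 f -> l2 (T f),
      forall (a : R[i]) f g, l2 f -> l2 g ->
        T (fun k => a * f k + g k) = (fun k => a * T f k + T g k) &
      forall f_ : nat -> int -> R[i],
        (exists M : R, forall n, (l2norm (f_ n) <= M%:E)%E) ->
        exists (phi : nat -> nat) (h : int -> R[i]),
          [/\ {homo phi : m n / (m < n)%N}, l2 h &
              (fun n => l2norm (fun k => T (f_ (phi n)) k - h k)) @ \oo --> 0%E]].

(* limsup_{|k| --> oo} = inf_N sup_{|k| >= N}, written out because [limf_esup]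
   needs a filtered type and [int] is not one *)
Definition limsup_symbol (R : realType) (sigma : int -> R -> R[i]) : \bar R :=
  ereal_inf [set
    ereal_sup [set
      ereal_sup [set (cabs (sigma k x))%:E | x in `[(- pi)%R, pi]]
      | k in [set k : int | (N <= `|k|)%N]]
    | N in [set: nat]].

(* Main.v *)
Require Import Defs.
From HB Require Import structures.
From mathcomp Require Import all_boot all_order all_algebra complex.
From mathcomp Require Import all_classical all_reals all_analysis.
From mathcomp Require Import measurable_realfun.
From mathcomp Require Import ring lra zify.

(** Let [a_k(m)] be the Fourier coefficients of the function [sigma(k, .)] on the torus.
    Inserting the Fourier series of [f] into the integral that defines [T_sigma] shows
    that [T_sigma] is the infinite matrix with the entries [a_k(l - k)]. For sequences
    in l^2 the Fourier transform is a limit in square mean, so this rests on its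
    existence, the Riesz-Fischer theorem ([fourier_transform_ex]), and on the
    continuity of the pairing with a bounded function ([pseudo_diff_matrix]).

    The symbol has order 0, so all its derivatives in [x] are bounded uniformly in [k],
    and [a_k(m)] decays like [|m| ^- 4] uniformly in [k]. It is also bounded by twice
    the supremum [s_k] of [|sigma(k, .)|]. Multiplying the two bounds gives
    [|a_k(m)| ^ 2 <= D * s_k * w(m) ^ 2] with a summable weight [w]
    ([symbol_matrix_bound]).

    If [d = 0], that is, if [s_k] tends to 0, Schur's test ([schur_bound]) bounds the
    norm of the part of [T_sigma f] carried by [|k| >= N] by the norm of [f] and the
    supremum of the [s_k] with [|k| >= N]. Bounded sequences are therefore mapped to
    bounded sequences with uniformly small tails, and these have convergent
    subsequences ([tight_compact]).

    If [T_sigma] is compact, consider the unit vectors. Their images are the columns of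
    the matrix, which tend to 0 entrywise as the column goes to infinity; by compactness
    they tend to 0 in norm along subsequences. Hence [a_k(m)] tends to 0 as [|k|] goes to
    infinity, uniformly for bounded [m]. It remains to see that this makes [s_k] small.
    The functions [sigma(k, .)] have a common Lipschitz constant, so up to a uniformly
    small error their values are averages against a fixed trigonometric kernel of some
    degree [n], and such averages involve only the coefficients with [|m| <= n]
    ([sup_le_coef]). The kernel is the [n]-th power of [(1 + cos (x - y)) / 2]; its mass
    obeys a two-term recursion in [n], which shows how fast it concentrates. *)

Set Implicit Arguments.
Unset Strict Implicit.
Unset Printing Implicit Defensive.
Import Order.TTheory GRing.Theory Num.Theory.
Import numFieldNormedType.Exports.
Local Open Scope classical_set_scope.
Local Open Scope complex_scope.
Local Open Scope ring_scope.

(** * Complex numbers and the unit circle *)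

Local Notation cRe := complex.Re.
Local Notation cIm := complex.Im.

Section Cabs.
Context {R : realType}.
Implicit Types (z w : R[i]) (t : R).

Lemma cReD z w : cRe (z + w) = cRe z + cRe w. Proof. by case: z; case: w. Qed.
Lemma cImD z w : cIm (z + w) = cIm z + cIm w. Proof. by case: z; case: w. Qed.
Lemma cReN z : cRe (- z) = - cRe z. Proof. by case: z. Qed.
Lemma cImN z : cIm (- z) = - cIm z. Proof. by case: z. Qed.
Lemma cReM z w : cRe (z * w) = cRe z * cRe w - cIm z * cIm w.
Proof. by case: z; case: w. Qed.
Lemma cImM z w : cIm (z * w) = cRe z * cIm w + cIm z * cRe w.
Proof. by case: z => a b; case: w. Qed.

Lemma complex_ext z w : cRe z = cRe w -> cIm z = cIm w -> z = w.
Proof. by case: z => a b; case: w => c d /= -> ->. Qed.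

Lemma cabs_ge0 z : 0 <= cabs z.
Proof. by case: z => a b; exact: sqrtr_ge0. Qed.
#[local] Hint Resolve cabs_ge0 : core.

Lemma cabs0 : cabs (0 : R[i]) = 0.
Proof. exact: ComplexField.Normc.normc0. Qed.

Lemma cabs1 : cabs (1 : R[i]) = 1.
Proof. exact: ComplexField.Normc.normc1. Qed.

Lemma cabsM z w : cabs (z * w) = cabs z * cabs w.
Proof. exact: ComplexField.Normc.normcM. Qed.

Lemma sqr_cabs z : cabs z ^+ 2 = cRe z ^+ 2 + cIm z ^+ 2.
Proof. by case: z => a b; rewrite /cabs /= sqr_sqrtr// addr_ge0 ?sqr_ge0. Qed.

Lemma cabsN z : cabs (- z) = cabs z.
Proof.
apply/eqP; rewrite -(@eqrXn2 _ 2)// !sqr_cabs cReN cImN.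
by apply/eqP; ring.
Qed.

Lemma cabsD z w : cabs (z + w) <= cabs z + cabs w.
Proof. exact: le_normcD. Qed.

Lemma cabsB z w : cabs (z - w) = cabs (w - z).
Proof. by rewrite -cabsN opprB. Qed.

Lemma cabs_sum (I : Type) (r : seq I) (P : pred I) (F : I -> R[i]) :
  cabs (\sum_(i <- r | P i) F i) <= \sum_(i <- r | P i) cabs (F i).
Proof.
elim/big_rec2 : _ => [|i y x _ h]; first by rewrite cabs0.
by apply: (le_trans (cabsD _ _)); rewrite lerD2l.
Qed.

Lemma cRe_cabs z : `|cRe z| <= cabs z.
Proof.
rewrite -(@ler_pXn2r _ 2) ?nnegrE// sqr_cabs real_normK ?num_real//.
by rewrite lerDl sqr_ge0.
Qed.

Lemma cIm_cabs z : `|cIm z| <= cabs z.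
Proof.
rewrite -(@ler_pXn2r _ 2) ?nnegrE// sqr_cabs real_normK ?num_real//.
by rewrite lerDr sqr_ge0.
Qed.

Lemma cabs_le_ReIm z : cabs z <= `|cRe z| + `|cIm z|.
Proof.
rewrite -(@ler_pXn2r _ 2) ?nnegrE// ?addr_ge0// sqr_cabs sqrrD.
rewrite !real_normK ?num_real// lerD2r lerDl.
by rewrite mulrn_wge0// mulr_ge0.
Qed.

Lemma cabs_eq0 z : cabs z = 0 -> z = 0.
Proof. exact: ComplexField.Normc.eq0_normc. Qed.

Lemma cabs_real t : cabs t%:C = `|t|.
Proof.
apply/eqP; rewrite -(@eqrXn2 _ 2)// sqr_cabs /= real_normK ?num_real//.
by rewrite expr0n addr0.
Qed.

Lemma sqr_cabsD z w : cabs (z + w) ^+ 2 <= 2 * cabs z ^+ 2 + 2 * cabs w ^+ 2.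
Proof.
rewrite !sqr_cabs cReD cImD.
have := sqr_ge0 (cRe z - cRe w); have := sqr_ge0 (cIm z - cIm w).
by move=> h1 h2; rewrite -subr_ge0; apply: le_trans (addr_ge0 h1 h2) _; lra.
Qed.

Lemma cabs_expi t : cabs (expi t) = 1.
Proof.
apply/eqP; rewrite -(@eqrXn2 _ 2)// sqr_cabs /= expr1n.
by rewrite cos2Dsin2.
Qed.

Lemma expiD s t : expi (s + t) = expi s * expi t :> R[i].
Proof.
apply: complex_ext; rewrite ?cReM ?cImM /=; first by rewrite cosD.
by rewrite sinD addrC.
Qed.

Lemma expi0 : expi 0 = 1 :> R[i].
Proof. by apply: complex_ext => /=; rewrite ?cos0 ?sin0. Qed.

End Cabs.

(** * Integration of complex functions over a period *)

Section PeriodIntegral.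
Context {R : realType}.
Notation mu := (@lebesgue_measure R).
Notation I := `[- pi, pi]%classic.
Implicit Types (f g : R -> R) (u v : R -> R[i]).

Lemma piNpi : - pi < pi :> R.
Proof. by rewrite gtrN// pi_gt0. Qed.

Lemma measure_I : mu I = (2 * pi)%:E.
Proof.
rewrite lebesgue_measure_itv /= lte_fin piNpi -EFinB; congr (_%:E); ring.
Qed.

Lemma integrable_cont f : continuous f -> mu.-integrable I (EFin \o f).
Proof.
move=> cf; apply: continuous_compact_integrable; first exact: segment_compact.
exact: continuous_subspaceT.
Qed.

Lemma Rintegral_cstI (c : R) : \int[mu]_(x in I) c = c * (2 * pi).
Proof. by rewrite Rintegral_cst//= [_ (Interval _ _)]/= -[X in fine X]/(mu I) measure_I. Qed.

Lemma derivable_continuous f : (forall x, derivable f x 1) -> continuous f.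
Proof.
by move=> df x; apply/differentiable_continuous; rewrite -derivable1_diffP.
Qed.

Lemma Rintegral_derive_periodic (F f : R -> R) :
  (forall x : R, is_derive x 1 F (f x)) -> continuous f -> F pi = F (- pi) ->
  \int[mu]_(x in I) f x = 0.
Proof.
move=> dF cf FF; rewrite /Rintegral (@continuous_FTC2 _ f F)//.
- by rewrite FF -EFinB subrr.
- exact: piNpi.
- exact: continuous_subspaceT.
- have cF : continuous F by apply: derivable_continuous => x; exact: ex_derive.
  split=> [x _| |].
  + exact: ex_derive.
  + exact/cvg_at_right_filter/cF.
  + exact/cvg_at_left_filter/cF.
- by move=> x _; rewrite derive1E; exact: derive_val.
Qed.

Definition ccont u := continuous (fun x => cRe (u x)) /\ continuous (fun x => cIm (u x)).

Definition cintegrable u :=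
  mu.-integrable I (fun x => (cRe (u x))%:E) /\ mu.-integrable I (fun x => (cIm (u x))%:E).

Lemma ccont_integrable u : ccont u -> cintegrable u.
Proof. by move=> [h1 h2]; split; exact: integrable_cont. Qed.

Lemma ccont_cst (c : R[i]) : ccont (fun=> c).
Proof. by split => x; exact: cvg_cst. Qed.

Lemma ccontD u v : ccont u -> ccont v -> ccont (fun x => u x + v x).
Proof.
move=> [u1 u2] [v1 v2]; split => x.
- rewrite (_ : (fun y => _) = (fun y => cRe (u y) + cRe (v y))); last first.
    by apply/funext => y; rewrite cReD.
  by apply: cvgD; [exact: u1|exact: v1].
- rewrite (_ : (fun y => _) = (fun y => cIm (u y) + cIm (v y))); last first.
    by apply/funext => y; rewrite cImD.
  by apply: cvgD; [exact: u2|exact: v2].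
Qed.

Lemma ccontM u v : ccont u -> ccont v -> ccont (fun x => u x * v x).
Proof.
move=> [u1 u2] [v1 v2]; split => x.
- rewrite (_ : (fun y => _) =
    (fun y => cRe (u y) * cRe (v y) - cIm (u y) * cIm (v y))); last first.
    by apply/funext => y; rewrite cReM.
  by apply: cvgB; apply: cvgM; [exact: u1|exact: v1|exact: u2|exact: v2].
- rewrite (_ : (fun y => _) =
    (fun y => cRe (u y) * cIm (v y) + cIm (u y) * cRe (v y))); last first.
    by apply/funext => y; rewrite cImM.
  by apply: cvgD; apply: cvgM; [exact: u1|exact: v2|exact: u2|exact: v1].
Qed.

Lemma ccontN u : ccont u -> ccont (fun x => - u x).
Proof.
move=> cu; rewrite (_ : (fun x => _) = (fun x => (-1) * u x)); last first.
  by apply/funext => x; rewrite mulN1r.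
exact: ccontM (ccont_cst _) cu.
Qed.

Lemma ccont_sum (J : Type) (r : seq J) (F : J -> R -> R[i]) :
  (forall j, ccont (F j)) -> ccont (fun x => \sum_(j <- r) F j x).
Proof.
move=> cF; elim: r => [|j r ih].
  rewrite (_ : (fun x => _) = fun=> 0); first exact: ccont_cst.
  by apply/funext => x; rewrite big_nil.
rewrite (_ : (fun x => _) = fun x => F j x + \sum_(j <- r) F j x).
  exact: ccontD.
by apply/funext => x; rewrite big_cons.
Qed.

Lemma ccont_expi (c d : R) : ccont (fun x => expi (c * x + d)).
Proof.
have h : continuous (fun x : R => c * x + d).
  by move=> x; apply: cvgD; [apply: cvgM; [exact: cvg_cst|exact: cvg_id]|exact: cvg_cst].
by split => x /=; [apply: (continuous_comp (h x)); exact: continuous_cos|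
  apply: (continuous_comp (h x)); exact: continuous_sin].
Qed.

Lemma ccont_real f : continuous f -> ccont (fun x => (f x)%:C).
Proof. by move=> cf; split => //= x; exact: cvg_cst. Qed.

Notation cint := (@cintegral R I).

Lemma cintegralD u v : cintegrable u -> cintegrable v ->
  cint (fun x => u x + v x) = cint u + cint v.
Proof.
move=> [u1 u2] [v1 v2]; apply: complex_ext.
- rewrite cReD /= -RintegralD//; congr Rintegral.
  by apply/funext => x; rewrite cReD.
- rewrite cImD /= -RintegralD//; congr Rintegral.
  by apply/funext => x; rewrite cImD.
Qed.

Lemma integrable_RZ f (c : R) : mu.-integrable I (fun x => (f x)%:E) ->
  mu.-integrable I (fun x => (c * f x)%:E).
Proof.
by move=> h; rewrite (_ : (fun x => _) = (fun x => c%:E * (f x)%:E)%E)//; exact: integrableZl.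
Qed.

Lemma integrable_RD f g : mu.-integrable I (fun x => (f x)%:E) ->
  mu.-integrable I (fun x => (g x)%:E) ->
  mu.-integrable I (fun x => (f x + g x)%:E).
Proof.
by move=> h k; rewrite (_ : (fun x => _) = (fun x => (f x)%:E + (g x)%:E)%E)//; exact: integrableD.
Qed.

Lemma cintegrableZ u (c : R[i]) : cintegrable u -> cintegrable (fun x => c * u x).
Proof.
move=> [u1 u2]; split.
- rewrite (_ : (fun x => _) =
    (fun x => (cRe c * cRe (u x) + (- cIm c) * cIm (u x))%:E)); last first.
    by apply/funext => x; rewrite cReM mulNr.
  by apply: integrable_RD; exact: integrable_RZ.
- rewrite (_ : (fun x => _) = (fun x => (cRe c * cIm (u x) + cIm c * cRe (u x))%:E)); last first.
    by apply/funext => x; rewrite cImM.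
  by apply: integrable_RD; exact: integrable_RZ.
Qed.

Lemma cintegrableD u v : cintegrable u -> cintegrable v -> cintegrable (fun x => u x + v x).
Proof.
move=> [u1 u2] [v1 v2]; split.
- rewrite (_ : (fun x => _) = (fun x => (cRe (u x) + cRe (v x))%:E)); last first.
    by apply/funext => x; rewrite cReD.
  exact: integrable_RD.
- rewrite (_ : (fun x => _) = (fun x => (cIm (u x) + cIm (v x))%:E)); last first.
    by apply/funext => x; rewrite cImD.
  exact: integrable_RD.
Qed.

Lemma cintegralZ u (c : R[i]) : cintegrable u -> cint (fun x => c * u x) = c * cint u.
Proof.
move=> [u1 u2]; apply: complex_ext.
- rewrite cReM /= -!RintegralZl// -RintegralB//; [|exact: integrable_RZ..].
  by congr Rintegral; apply/funext => x; rewrite cReM.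
- rewrite cImM /= -!RintegralZl// -RintegralD//; [|exact: integrable_RZ..].
  by congr Rintegral; apply/funext => x; rewrite cImM.
Qed.

Lemma cintegral0 : cint (fun=> 0) = 0.
Proof. by apply: complex_ext; rewrite /= Rintegral_cstI mul0r. Qed.

Lemma cintegral_sum (J : Type) (r : seq J) (F : J -> R -> R[i]) :
  (forall j, ccont (F j)) ->
  cint (fun x => \sum_(j <- r) F j x) = \sum_(j <- r) cint (F j).
Proof.
move=> cF; elim: r => [|j r ih].
  rewrite big_nil -[RHS]cintegral0; congr cintegral.
  by apply/funext => x; rewrite big_nil.
rewrite big_cons -ih -cintegralD; [|exact: ccont_integrable..|]; last first.
  by apply/ccont_integrable/ccont_sum.
by congr cintegral; apply/funext => x; rewrite big_cons.
Qed.

(** The factor 2 is the price of integrating the real and the imaginary part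
    separately. *)
Lemma cabs_cintegral u g : cintegrable u -> mu.-integrable I (EFin \o g) ->
  (forall x, I x -> cabs (u x) <= g x) ->
  cabs (cint u) <= 2 * \int[mu]_(x in I) g x.
Proof.
move=> [u1 u2] ig ug; apply: le_trans (cabs_le_ReIm _) _.
rewrite mulrDl mul1r; apply: lerD => /=.
- apply: le_trans (le_normr_Rintegral _ u1) _ => //.
  apply: le_Rintegral => //; first exact: (integrable_norm u1).
  by move=> x Ix; exact: le_trans (cRe_cabs _) (ug _ Ix).
- apply: le_trans (le_normr_Rintegral _ u2) _ => //.
  apply: le_Rintegral => //; first exact: (integrable_norm u2).
  by move=> x Ix; exact: le_trans (cIm_cabs _) (ug _ Ix).
Qed.

Lemma cabs_cintegral_le u (M : R) : cintegrable u ->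
  (forall x, I x -> cabs (u x) <= M) -> cabs (cint u) <= 4 * pi * M.
Proof.
move=> iu uM; apply: le_trans (@cabs_cintegral _ (cst M) iu _ uM) _.
  by apply: integrable_cont => x; exact: cvg_cst.
by rewrite /= Rintegral_cstI; lra.
Qed.

End PeriodIntegral.

(** * Fourier coefficients of smooth periodic functions *)

Section FourierCoef.
Context {R : realType}.
Notation mu := (@lebesgue_measure R).
Notation I := `[- pi, pi]%classic.
Notation cint := (@cintegral R I).
Implicit Types (f g : R -> R) (u v : R -> R[i]) (m l k : int).

(** The Fourier coefficient without its normalising factor [(2 * pi)^-1]. *)
Definition coef u m : R[i] := cint (fun x => u x * expi (- (m%:~R * x))).

Definition period2pi u := forall x, u (x + 2 * pi) = u x.

Lemma ccont_char m : ccont (fun x : R => expi (- (m%:~R * x)) : R[i]).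
Proof.
rewrite (_ : (fun x => _) = fun x : R => expi (- m%:~R * x + 0)); first exact: ccont_expi.
by apply/funext => x; rewrite addr0 mulNr.
Qed.

Lemma expi_nat_2pi (n : nat) : expi (n%:R * (2 * pi)) = 1 :> R[i].
Proof.
elim: n => [|n ih]; first by rewrite mul0r expi0.
rewrite -natr1 mulrDl expiD ih !mul1r; apply: complex_ext => /=.
  by rewrite mulr_natl cos2pi.
by rewrite mulr_natl sin2pi.
Qed.

Lemma expi_int_2pi m : expi (m%:~R * (2 * pi)) = 1 :> R[i].
Proof.
case: m => n; first exact: expi_nat_2pi.
rewrite NegzE mulrNz mulNr -[LHS]mul1r -(expi_nat_2pi n.+1) -expiD.
by rewrite pmulrn subrr expi0 -pmulrn expi_nat_2pi.
Qed.

Lemma char_periodic m : period2pi (fun x => expi (- (m%:~R * x))).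
Proof.
move=> x; rewrite -[RHS]mulr1 -(expi_int_2pi (- m)) -expiD; congr expi.
by rewrite mulrNz; ring.
Qed.

Lemma periodic_ends u : period2pi u -> u pi = u (- pi).
Proof. by move=> /(_ (- pi)) <-; congr u; ring. Qed.

Lemma is_derive_charRe m (x : R) :
  is_derive x 1 (fun x => cRe (expi (- (m%:~R * x)))) (m%:~R * cIm (expi (- (m%:~R * x)))).
Proof.
rewrite /=; have d : is_derive x 1 (fun x : R => - (m%:~R * x)) (- m%:~R).
  by apply: is_derive_eq; rewrite /GRing.scale /=; ring.
apply: (@is_derive_eq _ _ _ _ _ _ _ _ (is_derive1_comp _ _)).
by rewrite /=; ring.
Qed.

Lemma is_derive_charIm m (x : R) :
  is_derive x 1 (fun x => cIm (expi (- (m%:~R * x)))) (- m%:~R * cRe (expi (- (m%:~R * x)))).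
Proof.
rewrite /=; have d : is_derive x 1 (fun x : R => - (m%:~R * x)) (- m%:~R).
  by apply: is_derive_eq; rewrite /GRing.scale /=; ring.
apply: (@is_derive_eq _ _ _ _ _ _ _ _ (is_derive1_comp _ _)).
by rewrite /=; ring.
Qed.

Definition cis_derive (u du : R -> R[i]) := forall x : R,
  is_derive x 1 (fun y => cRe (u y)) (cRe (du x)) /\
  is_derive x 1 (fun y => cIm (u y)) (cIm (du x)).

Lemma cis_derive_char m : cis_derive (fun x => expi (- (m%:~R * x)))
  (fun x => - ((m%:~R)%:C * 'i * expi (- (m%:~R * x)))).
Proof.
move=> x; split.
  apply: (@is_derive_eq _ _ _ _ _ _ _ _ (is_derive_charRe _ _)).
  by rewrite cReN !cReM cImM /=; ring.
apply: (@is_derive_eq _ _ _ _ _ _ _ _ (is_derive_charIm _ _)).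
by rewrite cImN !cImM cReM /=; ring.
Qed.

Lemma cis_deriveM u v du dv : cis_derive u du -> cis_derive v dv ->
  cis_derive (fun x => u x * v x) (fun x => du x * v x + u x * dv x).
Proof.
move=> hu hv x; have [u1 u2] := hu x; have [v1 v2] := hv x; split.
- rewrite (_ : (fun y => _) =
    (fun y => cRe (u y)) * (fun y => cRe (v y))
     - (fun y => cIm (u y)) * (fun y => cIm (v y))); last first.
    by apply/funext => y; rewrite cReM.
  apply: is_derive_eq; rewrite cReD !cReM /GRing.scale /=; ring.
- rewrite (_ : (fun y => _) =
    (fun y => cRe (u y)) * (fun y => cIm (v y))
     + (fun y => cIm (u y)) * (fun y => cRe (v y))); last first.
    by apply/funext => y; rewrite cImM.
  apply: is_derive_eq; rewrite cImD !cImM /GRing.scale /=; ring.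
Qed.

Lemma cintegral_derive_periodic u du :
  cis_derive u du -> ccont du -> period2pi u -> cint du = 0.
Proof.
move=> hu [c1 c2] /periodic_ends pu; apply: complex_ext => /=.
- apply: (@Rintegral_derive_periodic _ (fun x => cRe (u x))) => //; last by rewrite pu.
  by move=> x; have [] := hu x.
- apply: (@Rintegral_derive_periodic _ (fun x => cIm (u x))) => //; last by rewrite pu.
  by move=> x; have [] := hu x.
Qed.

Lemma cis_derive_cont u du : cis_derive u du -> ccont u.
Proof.
by move=> h; split; apply: derivable_continuous => x; have [h1 h2] := h x;
  [exact: (@ex_derive _ _ _ _ _ _ _ h1)|exact: (@ex_derive _ _ _ _ _ _ _ h2)].
Qed.

(** Integration by parts: the product of [u] with a character is periodic, so the
    integral of its derivative over a period vanishes. *)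
Lemma coef_derive u du m : cis_derive u du -> ccont du -> period2pi u ->
  coef du m = (m%:~R)%:C * 'i * coef u m.
Proof.
move=> hu cdu pu.
have cu := cis_derive_cont hu; have cm := ccont_char m.
have := @cintegral_derive_periodic _ _ (cis_deriveM hu (cis_derive_char m)).
rewrite /coef -cintegralZ; last exact/ccont_integrable/ccontM.
have c2 : ccont (fun x => u x * - ((m%:~R)%:C * 'i * expi (- (m%:~R * x)))).
  by apply: ccontM => //; apply/ccontN/ccontM => //; exact: ccont_cst.
move=> /(_ _ _)/wrap[].
- by apply: ccontD => //; exact: ccontM.
- by move=> x; rewrite pu char_periodic.
rewrite cintegralD; [|exact/ccont_integrable/ccontM|exact/ccont_integrable].
move/eqP; rewrite addr_eq0 => /eqP ->.
rewrite -[LHS]mulN1r -cintegralZ; last exact/ccont_integrable.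
by congr cintegral; apply/funext => x; ring.
Qed.

Lemma csmooth_derive u n : csmooth u -> cis_derive (cderive n u) (cderive n.+1 u).
Proof.
move=> su x; have [h1 h2] := su n x; split.
  rewrite (_ : cRe (cderive n.+1 u x) = 'D_1 (derive1n n (fun y => cRe (u y))) x).
    exact: derivableP.
  by rewrite -derive1E.
rewrite (_ : cIm (cderive n.+1 u x) = 'D_1 (derive1n n (fun y => cIm (u y))) x).
  exact: derivableP.
by rewrite -derive1E.
Qed.

Lemma derive1_periodic f (c : R) :
  (forall x, f (x + c) = f x) -> forall x, derive1 f (x + c) = derive1 f x.
Proof.
move=> pf x; rewrite /derive1; rewrite (_ : (fun h => _) = (fun h => h^-1 *: (f (h + x) - f x)))//.
by apply/funext => h; rewrite addrA !pf.
Qed.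

Lemma periodic_derive u n : period2pi u -> period2pi (cderive n u).
Proof.
move=> pu x; have h : forall n, forall x : R,
  derive1n n (fun y => cRe (u y)) (x + 2 * pi) = derive1n n (fun y => cRe (u y)) x /\
  derive1n n (fun y => cIm (u y)) (x + 2 * pi) = derive1n n (fun y => cIm (u y)) x.
  elim=> [|j ih] y; first by rewrite /derive1n /= pu.
  rewrite !derive1nS.
  split.
    exact: (derive1_periodic (fun z => (ih z).1)).
  exact: (derive1_periodic (fun z => (ih z).2)).
by have [h1 h2] := h n x; rewrite /cderive h1 h2.
Qed.

Lemma csmooth_cont u n : csmooth u -> ccont (cderive n u).
Proof. by move=> su; exact: cis_derive_cont (csmooth_derive n su). Qed.

Lemma cderive0 u : cderive 0 u = u.
Proof. by apply/funext => x; rewrite /cderive /derive1n /=; case: (u x). Qed.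

Lemma coef_cderive u n m : csmooth u -> period2pi u ->
  coef (cderive n u) m = ((m%:~R)%:C * 'i) ^+ n * coef u m.
Proof.
move=> su pu; elim: n => [|n ih]; first by rewrite cderive0 expr0 mul1r.
rewrite (coef_derive _ (csmooth_derive n su)) ?ih ?exprS ?mulrA//.
  exact: csmooth_cont.
exact: periodic_derive.
Qed.

Lemma cabs_coef u m (M : R) : ccont u -> (forall x, I x -> cabs (u x) <= M) ->
  cabs (coef u m) <= 4 * pi * M.
Proof.
move=> cu uM; apply: cabs_cintegral_le.
  by apply/ccont_integrable/ccontM => //; exact: ccont_char.
by move=> x Ix; rewrite cabsM cabs_expi mulr1; exact: uM.
Qed.

Lemma cabsX (z : R[i]) n : cabs (z ^+ n) = cabs z ^+ n.
Proof. by elim: n => [|n ih]; rewrite ?expr0 ?cabs1// !exprS cabsM ih. Qed.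

Lemma cabs_i : cabs ('i : R[i]) = 1.
Proof.
by rewrite /cabs /ComplexField.Normc.normc /= expr0n expr1n add0r sqrtr1.
Qed.

(** Every derivative of [u] buys one power of the frequency. *)
Lemma coef_decay u m n (M : R) : csmooth u -> period2pi u ->
  (forall x, cabs (cderive n u x) <= M) ->
  `|m%:~R| ^+ n * cabs (coef u m) <= 4 * pi * M.
Proof.
move=> su pu uM.
rewrite -(_ : cabs (coef (cderive n u) m) = `|m%:~R| ^+ n * cabs (coef u m)).
  by apply: cabs_coef => //; exact: csmooth_cont.
by rewrite coef_cderive// cabsM cabsX cabsM cabs_i mulr1 cabs_real.
Qed.

(** For [m != 0], [coef_derive] applied to the constant function 1 says that [m]
    times this integral is 0. *)
Lemma cint_char m : cint (fun x => expi (- (m%:~R * x))) = if m == 0 then (2 * pi)%:C else 0.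
Proof.
have [->|m0] := eqVneq m 0.
  rewrite (_ : (fun x => _) = fun=> 1); last first.
    by apply/funext => x; rewrite mul0r oppr0 expi0.
  by apply: complex_ext; rewrite /= Rintegral_cstI ?mul1r ?mul0r.
have d1 : cis_derive (fun=> 1 : R[i]) (fun=> 0).
  by move=> x /=; split; exact: is_derive_cst.
have := coef_derive m d1 (ccont_cst _) (fun=> erefl).
rewrite {1}/coef (_ : (fun x => _) = fun=> 0); last first.
  by apply/funext => x; rewrite mul0r.
rewrite cintegral0 => /esym/eqP; rewrite mulf_eq0 => /orP[|/eqP].
  rewrite mulf_eq0 => /orP[|]; rewrite eq_complex /=.
    by rewrite eqxx andbT intr_eq0 (negbTE m0).
  by rewrite oner_eq0 andbF.
by rewrite /coef => <-; congr cintegral; apply/funext => x; rewrite mul1r.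
Qed.

End FourierCoef.

(** * Powers of a trigonometric bump *)

Section Kernel.
Context {R : realType}.
Notation mu := (@lebesgue_measure R).
Notation I := `[- pi, pi]%classic.
Notation cint := (@cintegral R I).
Implicit Types (f g : R -> R) (u v : R -> R[i]) (m l k : int) (y : R).

(** Its [n]-th power is a trigonometric polynomial of degree [n] which concentrates
    at [y], modulo the period, as [n] grows. *)
Definition cosbump y (x : R) : R := (1 + cos (x - y)) / 2.

Lemma cosbump_ge0 y x : 0 <= cosbump y x.
Proof. by rewrite divr_ge0// -(subrr 1) lerD2l cos_geN1. Qed.

Lemma cosbump_le1 y x : cosbump y x <= 1.
Proof. by rewrite ler_pdivrMr// mul1r (_ : 2 = 1 + 1)// lerD2l cos_le1. Qed.

Lemma is_derive_cosbump y (x : R) : is_derive x 1 (cosbump y) (- sin (x - y) / 2).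
Proof.
have d1 : is_derive x 1 (fun x : R => x - y) 1.
  by apply: is_derive_eq; rewrite subr0.
have d2 : is_derive x 1 (fun x : R => cos (x - y)) (- sin (x - y)).
  by apply: (@is_derive_eq _ _ _ _ _ _ _ _ (is_derive1_comp _ _)); rewrite mulr1.
rewrite (_ : cosbump y = (2^-1 : R) *: ((fun=> 1 : R) + (fun x : R => cos (x - y)))).
  by apply: is_derive_eq; rewrite /GRing.scale /=; ring.
by apply/funext => z; rewrite /cosbump /GRing.scale /= mulrC.
Qed.

Lemma is_derive_sinB y (x : R) : is_derive x 1 (fun x => sin (x - y)) (cos (x - y)).
Proof.
have d1 : is_derive x 1 (fun x : R => x - y) 1.
  by apply: is_derive_eq; rewrite subr0.
by apply: (@is_derive_eq _ _ _ _ _ _ _ _ (is_derive1_comp _ _)); rewrite mulr1.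
Qed.

Lemma cont_cosbump y : continuous (cosbump y).
Proof.
by apply: derivable_continuous => x; exact: (@ex_derive _ _ _ _ _ _ _ (is_derive_cosbump y x)).
Qed.

Lemma cont_cosbumpX y n : continuous (fun x => cosbump y x ^+ n).
Proof.
elim: n => [|n ih] x.
  by rewrite (_ : (fun x => _) = fun=> 1)//; exact: cvg_cst.
rewrite (_ : (fun x => _) = (fun x => cosbump y x * cosbump y x ^+ n)).
  by apply: cvgM; [exact: cont_cosbump|exact: ih].
by apply/funext => z; rewrite exprS.
Qed.

(** This is [2 * pi * 'C(2 * n, n) / 4 ^ n]. What matters is the ratio of consecutive
    masses: its convergence to 1 measures the concentration of the bump. *)
Fixpoint cosbump_mass (n : nat) : R :=
  if n is j.+1 then (2 * j%:R + 1) / (2 * j%:R + 2) * cosbump_mass j else 2 * pi.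

Lemma cosbump_mass_gt0 n : 0 < cosbump_mass n.
Proof.
elim: n => [|n ih] /=; first by rewrite mulr_gt0// pi_gt0.
by rewrite mulr_gt0// divr_gt0// ltr_wpDl// mulr_ge0.
Qed.

(** The derivative of [sin (x - y) * cosbump y x ^+ n] is a combination of the
    [n]-th and the [n.+1]-st power of the bump, and its integral vanishes. *)
Lemma integral_cosbumpX y n : \int[mu]_(x in I) (cosbump y x ^+ n) = cosbump_mass n.
Proof.
elim: n => [|n ih] /=; first by rewrite Rintegral_cstI mul1r.
have d (x : R) : is_derive x 1 (fun x => sin (x - y) * cosbump y x ^+ n)
   ((2 * n%:R + 2) * cosbump y x ^+ n.+1 - (2 * n%:R + 1) * cosbump y x ^+ n).
  have dX : is_derive x 1 (fun x => cosbump y x ^+ n)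
    (n%:R * cosbump y x ^+ n.-1 * (- sin (x - y) / 2)).
    rewrite -[X in is_derive _ _ X _](exprfctE (cosbump y)).
    exact: (is_deriveX _ (is_derive_cosbump y x)).
  apply: (@is_derive_eq _ _ _ _ _ _ _ _ (is_deriveM (is_derive_sinB y x) dX)).
  rewrite /GRing.scale /=.
  have cE : cos (x - y) = 2 * cosbump y x - 1 by rewrite /cosbump; field.
  have sE : sin (x - y) * sin (x - y) = 4 * cosbump y x * (1 - cosbump y x).
    by rewrite -expr2 sin2cos2 cE; ring.
  rewrite cE (_ : sin (x - y) * (n%:R * cosbump y x ^+ n.-1 * (- sin (x - y) / 2)) =
    - (n%:R * cosbump y x ^+ n.-1 * (sin (x - y) * sin (x - y)) / 2)); last by field.
  by rewrite sE; case: (n) => [|j] /=; rewrite !exprS ?expr0 -?natr1; field.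
have iX j : mu.-integrable I (fun x => (cosbump y x ^+ j)%:E).
  exact: (integrable_cont (@cont_cosbumpX y j)).
have := Rintegral_derive_periodic d.
rewrite RintegralB// ?RintegralZl//; [|exact: iX|exact: iX|exact: integrable_RZ..].
rewrite ih => h.
have {}h : (2 * n%:R + 2) * \int[mu]_(x in I) (cosbump y x ^+ n.+1) =
    (2 * n%:R + 1) * cosbump_mass n.
  apply/eqP; rewrite -subr_eq0; apply/eqP/h.
    move=> x; apply: cvgB; (apply: cvgM; [exact: cvg_cst|exact: cont_cosbumpX]).
  have e t : t + 2 * pi = t + pi + pi :> R by ring.
  have h1 : sin (pi - y) = sin (- pi - y).
    by rewrite -[pi - y](_ : - pi - y + pi *+ 2 = _) ?sinD2pi//; ring.
  have h2 : cos (pi - y) = cos (- pi - y).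
    by rewrite -[pi - y](_ : - pi - y + pi *+ 2 = _) ?cosD2pi//; ring.
  by rewrite /cosbump h1 h2.
have n0 : (2 * n%:R + 2 : R) != 0.
  by rewrite gt_eqF// ltr_wpDl// mulr_ge0.
by rewrite mulrAC -h mulrC mulKf.
Qed.

(** The bump has only the frequencies -1, 0 and 1, so that multiplying by it
    averages neighbouring coefficients. *)
Lemma coef_cosbump u m y : ccont u ->
  coef (fun x => u x * (cosbump y x)%:C) m =
  2^-1%:C * coef u m + (4^-1%:C * expi (- y)) * coef u (m - 1)
   + (4^-1%:C * expi y) * coef u (m + 1).
Proof.
move=> cu.
have ce k : cintegrable (fun x => u x * expi (- (k%:~R * x))).
  by apply/ccont_integrable/ccontM => //; exact: ccont_char.
rewrite /coef -!cintegralZ// -!cintegralD//;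
  [|by repeat first [exact: cintegrableZ|apply: cintegrableD]..].
congr cintegral; apply/funext => x.
have eB : expi (- ((m - 1)%:~R * x)) = expi (- (m%:~R * x)) * expi x :> R[i].
  by rewrite -expiD; congr expi; rewrite intrB; ring.
have eD : expi (- ((m + 1)%:~R * x)) = expi (- (m%:~R * x)) * expi (- x) :> R[i].
  by rewrite -expiD; congr expi; rewrite intrD; ring.
rewrite eB eD.
have bE : (cosbump y x)%:C =
    2^-1%:C + 4^-1%:C * (expi (- y) * expi x) + 4^-1%:C * (expi y * expi (- x)).
  rewrite -!expiD /cosbump; apply: complex_ext; rewrite !(cReD, cImD, cReM, cImM) /=.
    rewrite (_ : y - x = - (x - y)); last by ring.
    by rewrite cosN (addrC (- y)); field.
  rewrite (_ : y - x = - (x - y)); last by ring.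
  by rewrite sinN (addrC (- y)); field.
by rewrite bE; ring.
Qed.

(** The weights 1/2, 1/4, 1/4 in [coef_cosbump] have sum 1: each factor keeps the
    bound and shortens by one the range of frequencies on which it holds. *)
Lemma coef_cosbumpX n (M : nat) (eta : R) u y : ccont u ->
  (forall m, (`|m| <= M + n)%N -> cabs (coef u m) <= eta) ->
  forall m, (`|m| <= M)%N -> cabs (coef (fun x => u x * (cosbump y x ^+ n)%:C) m) <= eta.
Proof.
elim: n u => [|n ih] u cu hu m mM.
  rewrite (_ : (fun x => _) = u); first by apply: hu; rewrite addn0.
  by apply/funext => x; rewrite expr0 mulr1.
rewrite (_ : (fun x => _) = fun x => (u x * (cosbump y x)%:C) * (cosbump y x ^+ n)%:C); last first.
  by apply/funext => x; rewrite -mulrA -rmorphM -exprS.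
apply: ih => //.
  by apply: ccontM => //; apply: ccont_real; exact: cont_cosbump.
move=> k kM; rewrite coef_cosbump//.
apply: le_trans (cabsD _ _) _.
have h0 : cabs (coef u k) <= eta by apply: hu; lia.
have h1 : cabs (coef u (k - 1)) <= eta by apply: hu; lia.
have h2 : cabs (coef u (k + 1)) <= eta by apply: hu; lia.
apply: le_trans (lerD (cabsD _ _) (lexx _)) _.
rewrite !cabsM !cabs_expi !cabs_real !ger0_norm//.
lra.
Qed.

End Kernel.

(** * Uniform smallness from finitely many Fourier coefficients *)

Section SupBound.
Context {R : realType}.
Notation mu := (@lebesgue_measure R).
Notation I := `[- pi, pi]%classic.
Notation cint := (@cintegral R I).
Implicit Types (f g : R -> R) (u v : R -> R[i]) (m l k : int) (y : R).

Lemma lipschitz_is_derive f (df : R -> R) (M : R) : (forall x : R, is_derive x 1 f (df x)) ->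
  (forall x, `|df x| <= M) -> forall x y, `|f x - f y| <= M * `|x - y|.
Proof.
move=> hf hM x y.
wlog xy : x y / y <= x.
  move=> h; have [yx|/ltW xy] := leP y x; first exact: h.
  by rewrite distrC (distrC x); exact: h.
have cf : continuous f.
  by apply: derivable_continuous => z; exact: (@ex_derive _ _ _ _ _ _ _ (hf z)).
have [c _ ->] := @MVT_segment R f df y x xy (fun z _ => hf z) (continuous_subspaceT cf).
by rewrite normrM ler_wpM2r.
Qed.

Lemma clipschitz u (M : R) : csmooth u -> (forall x, cabs (cderive 1 u x) <= M) ->
  forall x y, cabs (u x - u y) <= 2 * M * `|x - y|.
Proof.
move=> su uM x y; have h := csmooth_derive 0 su; rewrite cderive0 in h.
apply: le_trans (cabs_le_ReIm _) _; rewrite cReD cReN cImD cImN.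
rewrite -mulrA mulrDl mul1r; apply: lerD.
  apply: (lipschitz_is_derive (fun x => (h x).1)) => z.
  exact: le_trans (cRe_cabs _) (uM z).
apply: (lipschitz_is_derive (fun x => (h x).2)) => z.
exact: le_trans (cIm_cabs _) (uM z).
Qed.

(** The assumption on [`|x - y|] says that [x] and [y] are at distance at least
    [d] on the circle. *)
Lemma cosbump_far (d : R) x y : 0 < d <= pi -> d <= `|x - y| <= 2 * pi - d ->
  cosbump y x <= (1 + cos d) / 2.
Proof.
move=> /andP[d0 dpi] /andP[h1 h2]; rewrite ler_pM2r// lerD2l -cos_norm.
have p0 := @pi_gt0 R.
have [le|gt] := leP `|x - y| pi.
  by rewrite leNgt ltr_cos ?in_itv/= -?leNgt// ?(ltW d0)// (le_trans (ltW d0) h1).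
rewrite -[leLHS]cosN -(cosD2pi (- _)) leNgt ltr_cos ?in_itv/= -?leNgt ?(ltW d0)//.
  by rewrite mulr2n; lra.
by rewrite mulr2n; apply/andP; split; lra.
Qed.

(** Near the diagonal of the torus the increment of a Lipschitz function is small,
    away from it the cosbump is bounded away from 1. *)
Lemma increment_le u (M0 M1 e : R) : period2pi u -> 0 < M0 -> 0 < M1 ->
  (forall x, cabs (u x) <= M0) ->
  (forall x y, cabs (u x - u y) <= M1 * `|x - y|) -> 0 < e ->
  forall x y, I x -> I y ->
  cabs (u x - u y) <= e +
     4 * M0 / (1 - cos (Num.min pi (e / M1))) * (1 - cosbump y x).
Proof.
move=> pu M00 M10 u0 u1 e0 x y; rewrite /= !in_itv /= => /andP[x1 x2] /andP[y1 y2].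
set d := Num.min _ _; have p0 := @pi_gt0 R.
have dd : 0 < d <= pi by rewrite lt_min p0 divr_gt0//= ge_min lexx.
have [d0 dp] := andP dd.
have cd : cos d < 1.
  rewrite -cos0 ltr_cos ?in_itv/= ?lexx ?(ltW d0) ?(ltW p0)//.
have Md : M1 * d <= e.
  by rewrite mulrC -ler_pdivlMr// /d ge_min lexx orbT.
have D0 : 0 <= 4 * M0 / (1 - cos d) * (1 - cosbump y x).
  by rewrite !mulr_ge0// ?(ltW M00)// ?invr_ge0 ?subr_ge0 ?cosbump_le1// ltW.
have small z : cabs (u x - u y) = cabs (u x - u z) -> `|x - z| <= d ->
    cabs (u x - u y) <= e.
  move=> -> h; apply: le_trans (u1 _ _) (le_trans _ Md).
  by rewrite ler_pM2l.
have near_ : cabs (u x - u y) <= e -> cabs (u x - u y) <=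
    e + 4 * M0 / (1 - cos d) * (1 - cosbump y x).
  by move=> h; rewrite -[leLHS]addr0; exact: lerD.
have [h1|h1] := leP `|x - y| d; first exact/near_/small/h1.
have [h2|h2] := leP `|x - y| (2 * pi - d).
  have hb := @cosbump_far d x y dd; rewrite ltW//= h2 in hb; have {}hb := hb isT.
  have hc : cabs (u x - u y) <= 2 * M0.
    by apply: le_trans (cabsD _ _) _; rewrite cabsN mulrDl !mul1r lerD.
  apply: (le_trans hc); rewrite -[leLHS]add0r; apply: lerD; first exact: ltW.
  rewrite mulrAC ler_pdivlMr ?subr_gt0//.
  rewrite (_ : 4 * M0 * (1 - cosbump y x) = 2 * M0 * (2 - 2 * cosbump y x)); last by ring.
  by rewrite ler_pM2l ?mulr_gt0//; lra.
(* Here [x] and [y] are close only modulo the period. *)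
apply: near_; have [yx|xy] := leP y x.
  apply: (small (y + 2 * pi)); first by rewrite pu.
  rewrite ger0_norm in h2; last by lra.
  by rewrite ler_norml; apply/andP; split; lra.
apply: (small (y - 2 * pi)).
  by rewrite -(pu (y - 2 * pi)) subrK.
rewrite ltr0_norm in h2; last by lra.
by rewrite ler_norml; apply/andP; split; lra.
Qed.

(** Integrate [u y = u x + (u y - u x)] over [x] against the [n]-th power of the bump
    centred at [y]. The first term gives the coefficient of frequency 0 of the
    product, which [coef_cosbumpX] bounds by the coefficients of [u] of frequency at
    most [n]. The second is bounded by [increment_le], because the integral of
    [1 - cosbump y] against the [n]-th power is only the fraction [1 / (2 * n + 2)]
    of the mass. One thus chooses [n] first, in terms of [e] and of the Lipschitz
    constant, and then [eta]. *)
Lemma sup_le_coef (M0 M1 e : R) : 0 < M0 -> 0 < M1 -> 0 < e ->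
  exists n : nat, exists2 eta : R, 0 < eta & forall u, csmooth u -> period2pi u ->
  (forall x, cabs (u x) <= M0) -> (forall x, cabs (cderive 1 u x) <= M1) ->
  (forall m, (`|m| <= n)%N -> cabs (coef u m) <= eta) ->
  forall x, I x -> cabs (u x) <= e.
Proof.
move=> M00 M10 e0; set e' := e / 8; have e'0 : 0 < e' by rewrite divr_gt0.
set D := 4 * M0 / (1 - cos (Num.min pi (e' / (2 * M1)))).
have D0 : 0 <= D.
  by rewrite divr_ge0// ?mulr_ge0// ?(ltW M00)// subr_ge0 cos_le1.
have [n hn] : exists n : nat, D / (n%:R + 1) <= e / 4.
  exists (Num.bound (4 * D / e)).
  have : 4 * D / e < (Num.bound (4 * D / e))%:R.
    by apply: archi_boundP; rewrite divr_ge0 ?mulr_ge0// ltW.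
  rewrite ltr_pdivrMr// => h; rewrite ler_pdivrMr; last by rewrite ltr_wpDl.
  by rewrite mulrDr mulr1; nra.
have n0 : 0 < n%:R + 1 :> R by rewrite ltr_wpDl.
exists n; exists (e / 4 * cosbump_mass n); first by rewrite mulr_gt0// ?cosbump_mass_gt0// divr_gt0.
move=> u su pu u0 u1 hc y Iy.
have cu : ccont u by rewrite -(cderive0 u); exact: csmooth_cont.
have M20 : 0 < 2 * M1 by rewrite mulr_gt0.
have inc := increment_le pu M00 M20 u0 (clipschitz su u1) e'0.
have ck j : ccont (fun x => (cosbump y x ^+ j)%:C) by apply: ccont_real; exact: cont_cosbumpX.
have c1 : ccont (fun x => u x * (cosbump y x ^+ n)%:C) by exact: ccontM.
have c2 : ccont (fun x => (u y - u x) * (cosbump y x ^+ n)%:C).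
  by apply: ccontM => //; apply: ccontD; [exact: ccont_cst|exact: ccontN].
have m0 := @cosbump_mass_gt0 R n.
have eL : cint (fun x => u y * (cosbump y x ^+ n)%:C) = u y * (cosbump_mass n)%:C.
  rewrite cintegralZ; last exact/ccont_integrable.
  by congr (_ * _); apply: complex_ext; rewrite /= ?integral_cosbumpX// Rintegral_cstI mul0r.
have eR : cint (fun x => u y * (cosbump y x ^+ n)%:C) =
  coef (fun x => u x * (cosbump y x ^+ n)%:C) 0
   + cint (fun x => (u y - u x) * (cosbump y x ^+ n)%:C).
  rewrite (_ : coef _ _ = cint (fun x => u x * (cosbump y x ^+ n)%:C)).
    rewrite -cintegralD; [|exact/ccont_integrable..].
    by congr cintegral; apply/funext => x; rewrite -mulrDl addrC subrK.
  by congr cintegral; apply/funext => x; rewrite mul0r oppr0 expi0 mulr1.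
have b1 : cabs (coef (fun x => u x * (cosbump y x ^+ n)%:C) 0) <= e / 4 * cosbump_mass n.
  exact: (@coef_cosbumpX _ n 0).
have iX j : mu.-integrable I (fun x => (cosbump y x ^+ j)%:E).
  exact: (integrable_cont (@cont_cosbumpX _ y j)).
have b2 : cabs (cint (fun x => (u y - u x) * (cosbump y x ^+ n)%:C)) <=
    2 * ((e' + D) * cosbump_mass n - D * cosbump_mass n.+1).
  have iD : mu.-integrable I
      (fun x => ((e' + D) * cosbump y x ^+ n + (- D) * cosbump y x ^+ n.+1)%:E).
    by apply: integrable_RD; exact: integrable_RZ.
  apply: le_trans (@cabs_cintegral _ _ _ (ccont_integrable c2) iD _) _.
    move=> x Ix; rewrite cabsM cabs_real ger0_norm ?exprn_ge0 ?cosbump_ge0//.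
    rewrite cabsB; apply: (@le_trans _ _ ((e' + D * (1 - cosbump y x)) * cosbump y x ^+ n)).
      by rewrite ler_wpM2r ?exprn_ge0 ?cosbump_ge0//; exact: inc.
    by rewrite exprS; lra.
  rewrite RintegralD//; [|exact: integrable_RZ..].
  by rewrite RintegralZl ?RintegralZl ?integral_cosbumpX ?mulNr//; exact: iX.
have {b2} b2 : cabs (cint (fun x => (u y - u x) * (cosbump y x ^+ n)%:C)) <=
    (2 * e' + D / (n%:R + 1)) * cosbump_mass n.
  apply: le_trans b2 _; rewrite le_eqVlt; apply/orP; left; apply/eqP => /=.
  by field; rewrite !gt_eqF//; lra.
have := cabsD (coef (fun x => u x * (cosbump y x ^+ n)%:C) 0)
  (cint (fun x => (u y - u x) * (cosbump y x ^+ n)%:C)).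
rewrite -eR eL cabsM cabs_real (gtr0_norm m0) => h.
rewrite -(ler_pM2r m0); apply: (le_trans h); apply: (le_trans (lerD b1 b2)).
rewrite -mulrDl ler_pM2r//; rewrite /e'; lra.
Qed.

End SupBound.

(** * Square-summable sequences on the integers *)

Section Windows.
Context {R : realType}.
Implicit Types (a b : int -> R) (f g h : int -> R[i]).

(** Enumerated in the order of summation of [fourier_sum]. *)
Definition window (N : nat) : seq int := [seq j%:Z - N%:Z | j <- index_iota 0 N.*2.+1].

Lemma mem_window N k : (k \in window N) = (`|k| <= N)%N.
Proof.
apply/mapP/idP => [[j]|kN].
  by rewrite mem_index_iota => /andP[_ jN] ->; lia.
exists (absz (k + N%:Z)); last by lia.
by rewrite mem_index_iota; lia.
Qed.

Lemma uniq_window N : uniq (window N).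
Proof. by rewrite map_inj_uniq ?iota_uniq// => i j /addIr[]. Qed.

Lemma sum_sub_uniq (T : choiceType) (s1 s2 : seq T) (a : T -> R) :
  uniq s1 -> uniq s2 -> {subset s1 <= s2} -> (forall k, 0 <= a k) ->
  \sum_(k <- s1) a k <= \sum_(k <- s2) a k.
Proof.
move=> u1 u2 s12 a0; rewrite [leRHS](bigID (fun k => k \in s1)) /=.
rewrite -[X in _ <= X + _]big_filter -[leLHS]addr0; apply: lerD; last exact: sumr_ge0.
rewrite le_eqVlt; apply/orP; left; apply/eqP/perm_big/uniq_perm => //.
  exact: filter_uniq.
move=> k; rewrite mem_filter; case: (boolP (k \in s1)) => //= /s12 ->//.
Qed.

Lemma sum_window_le a (N N' : nat) : (forall k, 0 <= a k) -> (N <= N')%N ->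
  \sum_(k <- window N) a k <= \sum_(k <- window N') a k.
Proof.
move=> a0 NN; apply: sum_sub_uniq => //; rewrite ?uniq_window// => k.
by rewrite !mem_window => /leq_trans; exact.
Qed.

Lemma sum_le_window (s : seq int) a : uniq s -> (forall k, 0 <= a k) ->
  exists N, \sum_(k <- s) a k <= \sum_(k <- window N) a k.
Proof.
move=> us a0; exists (\max_(k <- s) `|k|%N); apply: sum_sub_uniq => //.
  exact: uniq_window.
by move=> k ks; rewrite mem_window; exact: leq_bigmax_seq.
Qed.

(** Every sum over the integers is reduced to finite sums in this way. *)
Lemma esum_leP a (M : R) : (forall k, 0 <= a k) ->
  (\esum_(k in [set: int]) (a k)%:E <= M%:E)%E <->
  (forall N, \sum_(k <- window N) a k <= M).
Proof.
move=> a0; split=> [h N|h].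
  rewrite -lee_fin; apply: le_trans h; apply: esum_ge.
  exists [set` window N]; first by split => //; exact: finite_seq.
  by rewrite -(@fsbig_seq _ _ _ _ _ _ (uniq_window N)) sumEFin.
apply: ge_ereal_sup => /= _ [A [finA _] <-].
rewrite fsbig_finite//= sumEFin lee_fin.
have [N /le_trans] := @sum_le_window (finmap.enum_fset (fset_set A)) a (finmap.fset_uniq _) a0.
by apply.
Qed.

Lemma esum_ltyP a : (forall k, 0 <= a k) ->
  (\esum_(k in [set: int]) (a k)%:E < +oo)%E <->
  (exists M : R, forall N, \sum_(k <- window N) a k <= M).
Proof.
move=> a0; have e0 : (0 <= \esum_(k in [set: int]) (a k)%:E)%E.
  by apply: esum_ge0 => k _; rewrite lee_fin.
split=> [h|[M /(esum_leP M a0) h]]; last exact: le_lt_trans h (ltry _).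
exists (fine (\esum_(k in [set: int]) (a k)%:E)); apply/esum_leP => //.
by rewrite fineK// ge0_fin_numE.
Qed.

Lemma l2P f : l2 f <-> exists M : R, forall N, \sum_(k <- window N) cabs (f k) ^+ 2 <= M.
Proof.
rewrite -esum_ltyP; last by move=> k; exact: sqr_ge0.
split; first by apply: lty_poweRy; rewrite invr_eq0.
exact: poweR_lty.
Qed.

Lemma l2norm_leP f (M : R) : 0 <= M ->
  (l2norm f <= M%:E)%E <-> forall N, \sum_(k <- window N) cabs (f k) ^+ 2 <= M ^+ 2.
Proof.
move=> M0; rewrite -esum_leP; last by move=> k; exact: sqr_ge0.
have MM : M%:E = sqrte (M ^+ 2)%:E by rewrite /= sqrtr_sqr ger0_norm.
rewrite /l2norm poweR12_sqrt; last by apply: esum_ge0 => k _; rewrite lee_fin sqr_ge0.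
by rewrite MM lee_sqrt// lee_fin sqr_ge0.
Qed.

Lemma l2_lin (c : R[i]) f g : l2 f -> l2 g -> l2 (fun k => c * f k + g k).
Proof.
move=> /l2P[M hM] /l2P[M' hM']; apply/l2P.
exists (2 * (cabs c ^+ 2 * M) + 2 * M') => N.
apply: (@le_trans _ _ (\sum_(k <- window N)
   (2 * (cabs c ^+ 2 * cabs (f k) ^+ 2) + 2 * cabs (g k) ^+ 2))).
  by apply: ler_sum => k _; apply: le_trans (sqr_cabsD _ _) _; rewrite cabsM exprMn.
rewrite big_split /= -!mulr_sumr; apply: lerD; rewrite ler_pM2l//.
by apply: ler_wpM2l => //; exact: sqr_ge0.
Qed.

Lemma fourier_sumE f N (x : R) :
  fourier_sum f N x = \sum_(k <- window N) f k * expi (- (k%:~R * x)).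
Proof. by rewrite /fourier_sum /window big_map. Qed.

End Windows.

(** * Completeness of L^2 over a period *)

Section SquareIntegrable.
Context {R : realType}.
Notation mu := (@lebesgue_measure R).
Notation I := `[- pi, pi]%classic.
Notation cint := (@cintegral R I).
Implicit Types (u v g : R -> R[i]).

Definition L2sq u : \bar R := \int[mu]_(x in I) ((cabs (u x) ^+ 2)%:E).

Lemma ccont_measurable u : ccont u -> cmeasurable I u.
Proof.
by move=> /ccont_integrable[/integrableP[h1 _] /integrableP[h2 _]]; split; exact/measurable_EFinP.
Qed.

Lemma cmeasurableB u v : cmeasurable I u -> cmeasurable I v -> cmeasurable I (fun x => u x - v x).
Proof.
move=> [u1 u2] [v1 v2]; split.
- rewrite (_ : (fun x => _) = (fun x => cRe (u x)) \- (fun x => cRe (v x))).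
    exact: measurable_funB.
  by apply/funext => x; rewrite cReD cReN.
- rewrite (_ : (fun x => _) = (fun x => cIm (u x)) \- (fun x => cIm (v x))).
    exact: measurable_funB.
  by apply/funext => x; rewrite cImD cImN.
Qed.

Lemma cmeasurableD u v : cmeasurable I u -> cmeasurable I v -> cmeasurable I (fun x => u x + v x).
Proof.
move=> [u1 u2] [v1 v2]; split.
- rewrite (_ : (fun x => _) = (fun x => cRe (u x)) \+ (fun x => cRe (v x))).
    exact: measurable_funD.
  by apply/funext => x; rewrite cReD.
- rewrite (_ : (fun x => _) = (fun x => cIm (u x)) \+ (fun x => cIm (v x))).
    exact: measurable_funD.
  by apply/funext => x; rewrite cImD.
Qed.

Lemma cmeasurableM u v : cmeasurable I u -> cmeasurable I v -> cmeasurable I (fun x => u x * v x).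
Proof.
move=> [u1 u2] [v1 v2]; split.
- rewrite (_ : (fun x => _) = ((fun x => cRe (u x)) \* (fun x => cRe (v x)))
     \- ((fun x => cIm (u x)) \* (fun x => cIm (v x)))).
    by apply: measurable_funB; exact: measurable_funM.
  by apply/funext => x; rewrite cReM.
- rewrite (_ : (fun x => _) = ((fun x => cRe (u x)) \* (fun x => cIm (v x)))
     \+ ((fun x => cIm (u x)) \* (fun x => cRe (v x)))).
    by apply: measurable_funD; exact: measurable_funM.
  by apply/funext => x; rewrite cImM.
Qed.

Lemma cmeasurable_sqr u : cmeasurable I u -> measurable_fun I (fun x => (cabs (u x) ^+ 2)%:E).
Proof.
move=> [u1 u2]; apply/measurable_EFinP.
rewrite (_ : (fun x => _) = (fun x => cRe (u x) ^+ 2) \+ (fun x => cIm (u x) ^+ 2)).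
  by apply: measurable_funD; exact: measurable_funX.
by apply/funext => x; rewrite sqr_cabs.
Qed.

Lemma L2sqD u v : cmeasurable I u -> cmeasurable I v ->
  (L2sq (fun x => (u x + v x)%R) <= 2%:E * L2sq u + 2%:E * L2sq v)%E.
Proof.
move=> mU mv; have muv := cmeasurableD mU mv; rewrite /L2sq.
have sq0 (w : R -> R[i]) x : I x -> (0 <= (cabs (w x) ^+ 2)%:E)%E.
  by rewrite lee_fin sqr_ge0.
have sq2 (w : R -> R[i]) x : I x -> (0 <= 2%:E * (cabs (w x) ^+ 2)%:E)%E.
  by rewrite -EFinM lee_fin mulr_ge0// sqr_ge0.
have ms2 (w : R -> R[i]) : cmeasurable I w ->
    measurable_fun I (fun x => 2%:E * (cabs (w x) ^+ 2)%:E)%E.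
  by move=> mw; apply: measurable_funeM; exact: cmeasurable_sqr.
rewrite -!ge0_integralZl//; [|by first [exact: cmeasurable_sqr|exact: sq0]..].
rewrite -ge0_integralD//; [|exact: sq2|exact: ms2|exact: sq2|exact: ms2].
apply: ge0_le_integral => //; first exact: sq0.
- exact: cmeasurable_sqr.
- by apply: emeasurable_funD; exact: ms2.
- by move=> x Ix; rewrite -!EFinM -EFinD lee_fin; exact: sqr_cabsD.
Qed.

Lemma limn_einf_le (a : (\bar R)^nat) (c : \bar R) (i : nat) :
  (forall j, (i <= j)%N -> (a j <= c)%E) -> (limn_einf a <= c)%E.
Proof.
move=> h; rewrite limn_einf_lim; apply: lime_le; first exact: is_cvg_einfs.
near=> n; apply: le_trans (h n _); last by near: n; exists i.
by apply: ereal_inf_lbound; exists n => /=.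
Unshelve. all: by end_near. Qed.

Lemma geometric_cvg (p : nat -> R) (C : R) :
  (forall j, `|p j.+1 - p j| <= C * 2^-1 ^+ j) -> cvgn p.
Proof.
move=> h; have C0 : 0 <= C by have := h 0; rewrite expr0 mulr1; apply: le_trans.
have cs : cvgn (series (telescope p)).
  apply: normed_cvg; apply: (@series_le_cvg _ _ (geometric C 2^-1)) => //.
  - by move=> n /=; exact: normr_ge0.
  - by move=> n /=; rewrite mulr_ge0// exprn_ge0.
  - by apply: is_cvg_geometric_series; rewrite ger0_norm// invf_lt1// ltr1n.
rewrite (_ : p = fun n => p 0 + series (telescope p) n).
  by apply: is_cvgD => //; exact: is_cvg_cst.
by apply/funext => n; exact: eq_sum_telescope.
Qed.

(** Let [H] be the sum of the [4 ^+ j * |u j.+1 - u j| ^+ 2]. The assumed rate makes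
    its integral finite, so [H] is finite almost everywhere; there the increments
    of [u] are at most [sqrt H / 2 ^+ j], and [u] converges pointwise. Fatou's lemma
    carries the estimates in square mean over to the limit. *)
Lemma L2_fast_cauchy (u : nat -> R -> R[i]) : (forall j, ccont (u j)) ->
  (forall i j, (i <= j)%N -> (L2sq (fun x => (u j x - u i x)%R) <= ((2 * 8 ^+ i)^-1)%:E)%E) ->
  exists2 g, cmeasurable I g &
    forall i, (L2sq (fun x => (g x - u i x)%R) <= ((2 * 8 ^+ i)^-1)%:E)%E.
Proof.
move=> cu hu.
have mU j := ccont_measurable (cu j).
pose h j x : \bar R := ((4 ^+ j)%:E * (cabs (u j.+1 x - u j x) ^+ 2)%:E)%E.
have h0 j x : (0 <= h j x)%E by rewrite /h -EFinM lee_fin mulr_ge0 ?sqr_ge0//.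
have md j i : measurable_fun I (fun x => (cabs (u j x - u i x) ^+ 2)%:E).
  by apply: cmeasurable_sqr; exact: cmeasurableB.
have mh j : measurable_fun I (h j) by apply: measurable_funeM; exact: md.
pose H x : \bar R := (\sum_(j <oo) h j x)%E.
have mH : measurable_fun I H by apply: ge0_emeasurable_sum.
have iH : (\int[mu]_(x in I) H x <= 1%:E)%E.
  rewrite /H integral_nneseries//.
  apply: (le_trans _ (@epsilon_trick0 R 1 xpredT _)) => //.
  apply: lee_nneseries => [j *|j *]; first exact: integral_ge0.
  rewrite /h ge0_integralZl//; first last.
  - by move=> x _; rewrite lee_fin sqr_ge0.
  - exact: md.
  apply: (@le_trans _ _ ((4 ^+ j)%:E * ((2 * 8 ^+ j)^-1)%:E)%E).
    by apply: lee_wpmul2l; [rewrite lee_fin exprn_ge0|exact: hu].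
  rewrite -EFinM lee_fin natrX exprS (_ : 8 = 4 * 2 :> R); last by ring.
  rewrite exprMn; have : 4 ^+ j != 0 :> R by rewrite expf_neq0.
  have : 2 ^+ j != 0 :> R by rewrite expf_neq0.
  move: (4 ^+ j) (2 ^+ j) => p q q0 p0.
  by rewrite le_eqVlt; apply/orP; left; apply/eqP; field; rewrite p0 q0.
have intH : mu.-integrable I H.
  apply/integrableP; split => //.
  under eq_integral => x _ do rewrite gee0_abs ?nneseries_ge0//.
  exact: le_lt_trans iH (ltry _).
have good x : H x \is a fin_num -> cvgn (fun j => cRe (u j x)) /\ cvgn (fun j => cIm (u j x)).
  move=> fH; have b j : cabs (u j.+1 x - u j x) <= Num.sqrt (fine (H x)) * 2^-1 ^+ j.
    have hj : (h j x <= H x)%E.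
      apply: le_trans (@nneseries_lim_ge _ (h ^~ x) xpredT 0 j.+1 _) => //.
      by rewrite big_nat_recr//= leeDr// sume_ge0.
    have hf0 : 0 <= fine (H x) by rewrite fine_ge0// nneseries_ge0.
    rewrite -(fineK fH) /h -EFinM lee_fin in hj.
    rewrite -(@ler_pXn2r _ 2) ?nnegrE ?cabs_ge0 ?mulr_ge0 ?sqrtr_ge0 ?exprn_ge0//.
    rewrite exprMn sqr_sqrtr// -exprM mulnC exprM.
    rewrite (_ : 2^-1 ^+ 2 = 4^-1 :> R); last by field.
    by rewrite exprVn ler_pdivlMr ?exprn_gt0// mulrC.
  split; apply: (@geometric_cvg _ (Num.sqrt (fine (H x)))) => j; apply: le_trans (b j).
    by rewrite -cReN -cReD; exact: cRe_cabs.
  by rewrite -cImN -cImD; exact: cIm_cabs.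
(* The upper limit is measurable whether or not the sequence converges. *)
pose g x : R[i] := fine (limn_esup (fun j => (cRe (u j x))%:E)) +i*
                   fine (limn_esup (fun j => (cIm (u j x))%:E)).
have mg : cmeasurable I g.
  split; apply: measurableT_comp => //; apply: measurable_fun_limn_esup => j;
    by apply/measurable_EFinP; have [] := mU j.
exists g => // i; apply: (@le_trans _ _ (\int[mu]_(x in I)
    limn_einf (fun j => (cabs (u j x - u i x) ^+ 2)%:E))%E).
  have f0 x : I x -> (0 <= limn_einf (fun j => (cabs (u j x - u i x) ^+ 2)%:E))%E.
    move=> _; rewrite limn_einf_lim; apply: lime_ge; first exact: is_cvg_einfs.
    by apply: nearW => n; apply: le_ereal_inf_tmp => _ [k _ <-]; rewrite lee_fin sqr_ge0.
  apply: ae_ge0_le_integral => //.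
  - by move=> x _; rewrite lee_fin sqr_ge0.
  - by apply: cmeasurable_sqr; exact: cmeasurableB.
  - rewrite (_ : (fun x => _) =
        fun x => (- limn_esup (fun j => - (cabs (u j x - u i x) ^+ 2)%:E))%E); last first.
      apply/funext => x.
      by rewrite (limn_esupN (fun j => (cabs (u j x - u i x) ^+ 2)%:E)) oppeK.
    apply: measurableT_comp => //; apply: measurable_fun_limn_esup => j.
    by apply: measurableT_comp => //; exact: md.
  have := integrable_ae _ intH; move=> /(_ (measurable_itv _)); apply: filterS => x hx Ix.
  have [c1 c2] := good x (hx Ix).
  have lE (p : nat -> R) : cvgn p -> fine (limn_esup (fun j => (p j)%:E)) = limn p.
    move=> cp; have : (fun j => (p j)%:E) @ \oo --> (limn p)%:E.
      by apply: cvg_EFin; [exact: nearW|exact: cp].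
    by move=> /cvg_limn_einf_sup[_ ->].
  have cv : (fun j => (cabs (u j x - u i x) ^+ 2)%:E) @ \oo --> (cabs (g x - u i x) ^+ 2)%:E.
    apply/cvg_EFin; first exact: nearW.
    rewrite (_ : _ \o _ = fun j =>
        (cRe (u j x) - cRe (u i x)) ^+ 2 + (cIm (u j x) - cIm (u i x)) ^+ 2).
      rewrite sqr_cabs cReD cImD cReN cImN /= !lE// !expr2.
      by apply: cvgD; apply: cvgM; apply: cvgB => //; exact: cvg_cst.
    by apply/funext => j /=; rewrite sqr_cabs cReD cImD cReN cImN.
  by have [-> _] := cvg_limn_einf_sup cv.
apply: (le_trans (@fatou _ _ _ mu I _ (fun j x => (cabs (u j x - u i x) ^+ 2)%:E) _ _)).
- exact: measurable_itv.
- by move=> j; exact: md.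
- by move=> j x _; rewrite lee_fin sqr_ge0.
by apply: (@limn_einf_le _ _ i) => j ij; exact: hu.
Qed.

End SquareIntegrable.

(** * The Fourier transform of a square-summable sequence *)

Section FourierTransform.
Context {R : realType}.
Notation mu := (@lebesgue_measure R).
Notation I := `[- pi, pi]%classic.
Notation cint := (@cintegral R I).
Implicit Types (u v g h : R -> R[i]) (f : int -> R[i]).

Lemma cvg0_eps (a : (\bar R)^nat) : (forall n, (0 <= a n)%E) ->
  (a @ \oo --> 0%E) <-> (forall e : R, 0 < e -> exists N, forall n, (N <= n)%N -> (a n <= e%:E)%E).
Proof.
move=> a0; split=> [/fine_cvgP[fa ca] e e0|h].
  have [N _ hN] := fa; move/cvgrPdist_le : ca => /(_ e e0)[N' _ hN'].
  exists (maxn N N') => n; rewrite geq_max => /andP[nN nN'].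
  rewrite -(fineK (hN n nN)) lee_fin; have := hN' n nN'.
  by rewrite /= sub0r normrN; apply: le_trans; exact: ler_norm.
apply/fine_cvgP; split.
  have [N hN] := h 1 ltr01; exists N => // n /= nN.
  by rewrite ge0_fin_numE//; exact: le_lt_trans (hN n nN) (ltry _).
apply/cvgrPdist_le => e e0; have [N hN] := h e e0; exists N => // n /= nN.
rewrite sub0r normrN ger0_norm ?fine_ge0// -lee_fin fineK ?hN//.
by rewrite ge0_fin_numE//; exact: le_lt_trans (hN n nN) (ltry _).
Qed.

Lemma mulc_conj (z : R[i]) : z * conjc z = (cabs z ^+ 2)%:C.
Proof.
by rewrite sqr_cabs; case: z => a b; apply: complex_ext; rewrite ?cReM ?cImM /=; ring.
Qed.

Lemma conjcM (z w : R[i]) : conjc (z * w) = conjc z * conjc w.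
Proof. by apply: complex_ext; case: z => a b; case: w => c d /=; ring. Qed.

Lemma conj_expi (t : R) : conjc (expi t) = expi (- t) :> R[i].
Proof. by apply: complex_ext; rewrite /= ?cosN ?sinN. Qed.

Lemma L2sq_cont u : ccont u -> L2sq u = (\int[mu]_(x in I) (cabs (u x) ^+ 2))%:E.
Proof.
move=> [c1 c2]; rewrite /L2sq /Rintegral fineK//.
apply: integrable_fin_num => //.
apply: (@integrable_cont _ (fun x => cabs (u x) ^+ 2)) => x.
rewrite (_ : (fun x => _) = fun x => cRe (u x) * cRe (u x) + cIm (u x) * cIm (u x)).
  by apply: cvgD; apply: cvgM; [exact: c1|exact: c1|exact: c2|exact: c2].
by apply/funext => y; rewrite sqr_cabs !expr2.
Qed.

Lemma parseval_sum (s : seq int) (c : int -> R[i]) : uniq s ->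
  L2sq (fun x => (\sum_(k <- s) c k * expi (- (k%:~R * x)))%R) =
  (2 * pi * \sum_(k <- s) cabs (c k) ^+ 2)%:E.
Proof.
move=> us; rewrite L2sq_cont; last first.
  by apply: ccont_sum => k; apply: ccontM; [exact: ccont_cst|exact: ccont_char].
congr (_%:E); pose S x := \sum_(k <- s) c k * expi (- (k%:~R * x)).
rewrite -[LHS]/(cRe (cint (fun x => (cabs (S x) ^+ 2)%:C))).
have -> : (fun x => (cabs (S x) ^+ 2)%:C) = (fun x => \sum_(k <- s) \sum_(l <- s)
    (c k * conjc (c l)) * expi (- ((k - l)%:~R * x))).
  apply/funext => x; rewrite -mulc_conj /S rmorph_sum /= mulr_suml; apply: eq_bigr => k _.
  rewrite mulr_sumr; apply: eq_bigr => l _.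
  rewrite (_ : conjc (c l * expi _) = conjc (c l) * expi (- - (l%:~R * x))); last first.
    by rewrite conjcM conj_expi.
  rewrite (_ : - ((k - l)%:~R * x) = - (k%:~R * x) + - - (l%:~R * x)); last by rewrite intrB; ring.
  by rewrite expiD; ring.
have cc k l : ccont (fun x => (c k * conjc (c l)) * expi (- ((k - l)%:~R * x))).
  by apply: ccontM; [exact: ccont_cst|exact: ccont_char].
rewrite cintegral_sum; last by move=> k; exact: ccont_sum.
rewrite (_ : \sum_(k <- s) _ = (2 * pi)%:C * (\sum_(k <- s) cabs (c k) ^+ 2)%:C).
  by rewrite cReM /= mulr0 subr0.
rewrite rmorph_sum /= mulr_sumr big_seq [RHS]big_seq; apply: eq_bigr => k ks.
rewrite cintegral_sum// (bigD1_seq k)//= cintegralZ; last exact/ccont_integrable/ccont_char.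
rewrite cint_char subrr eqxx mulc_conj mulrC big1 ?addr0// => l lk.
rewrite cintegralZ; last exact/ccont_integrable/ccont_char.
by rewrite cint_char subr_eq0 eq_sym (negbTE lk) mulr0.
Qed.

Lemma big_window_sub (V : nmodType) (a : int -> V) (N M : nat) : (N <= M)%N ->
  \sum_(k <- window M) (if k \in window N then a k else 0) = \sum_(k <- window N) a k.
Proof.
move=> NM; rewrite -big_mkcond /= -big_filter; apply/perm_big/uniq_perm => //.
- exact/filter_uniq/uniq_window.
- exact: uniq_window.
- move=> k; rewrite mem_filter !mem_window; case: leqP => //= kN.
  exact: leq_trans kN NM.
Qed.

Lemma ccont_fourier_sum f N : ccont (fourier_sum f N).
Proof.
rewrite (_ : fourier_sum f N = fun x => \sum_(k <- window N) f k * expi (- (k%:~R * x))).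
  by apply: ccont_sum => k; apply: ccontM; [exact: ccont_cst|exact: ccont_char].
by apply/funext => x; rewrite fourier_sumE.
Qed.

Lemma L2sq_fourier_sumB f (N M : nat) : (N <= M)%N ->
  L2sq (fun x => (fourier_sum f M x - fourier_sum f N x)%R) =
  (2 * pi * (\sum_(k <- window M) cabs (f k) ^+ 2 - \sum_(k <- window N) cabs (f k) ^+ 2))%:E.
Proof.
move=> NM; pose c k := if k \in window N then 0 else f k.
rewrite (_ : (fun x => _) = fun x => \sum_(k <- window M) c k * expi (- (k%:~R * x))).
  rewrite parseval_sum ?uniq_window//; congr (_ * _)%:E.
  rewrite -(big_window_sub _ NM) -sumrB; apply: eq_bigr => k _; rewrite /c.
  by case: ifP => _; rewrite ?cabs0 ?expr0n ?subrr ?subr0.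
apply/funext => x; rewrite !fourier_sumE -(big_window_sub _ NM) -sumrB.
by apply: eq_bigr => k _; rewrite /c; case: ifP => _; rewrite ?mul0r ?subrr ?subr0.
Qed.

Lemma bounded_mono_cauchy (W : nat -> R) (M e : R) :
  (forall n m, (n <= m)%N -> W n <= W m) -> (forall n, W n <= M) -> 0 < e ->
  exists N, forall n, (N <= n)%N -> W n - W N <= e.
Proof.
move=> mW bW e0; have hs : has_sup (range W).
  by split; [exists (W 0); exists 0|exists M => _ [n _ <-]].
have [_ [N _ <-] hN] := sup_adherent e0 hs; exists N => n _.
have : W n <= sup (range W) by apply: ub_le_sup; [case: hs|exists n].
by lra.
Qed.

(** Riesz and Fischer: by orthogonality the partial sums are Cauchy in square mean.
    [L2_fast_cauchy] yields a limit along a subsequence, which is then a limit of the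
    whole sequence. *)
Lemma fourier_transform_ex f : l2 f -> exists g, is_fourier_transform f g.
Proof.
move=> /l2P[M hM]; pose W N := \sum_(k <- window N) cabs (f k) ^+ 2.
have mW n m : (n <= m)%N -> W n <= W m.
  by move=> nm; apply: sum_window_le => // k; exact: sqr_ge0.
have p0 := @pi_gt0 R.
pose d i : R := (2 * 8 ^+ i)^-1.
have d0 i : 0 < d i by rewrite invr_gt0 mulr_gt0// exprn_gt0.
have [N0 hN0] : {N0 : nat -> nat & forall i n, (N0 i <= n)%N -> W n - W (N0 i) <= d i / (2 * pi)}.
  apply: (@boolp.choice _ _ (fun i m => forall n, (m <= n)%N -> W n - W m <= d i / (2 * pi))) => i.
  by apply: (@bounded_mono_cauchy W M) => //; rewrite divr_gt0// mulr_gt0.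
(* The running maximum makes the sequence of truncations nondecreasing. *)
pose N i := (\max_(j < i.+1) N0 j)%N.
have NN i j : (i <= j)%N -> (N i <= N j)%N.
  move=> ij; apply/bigmax_leqP => k _.
  have kj : (k < j.+1)%N by apply: leq_trans (ltn_ord k) _.
  exact: (@leq_bigmax _ (fun j : 'I_j.+1 => N0 j) (Ordinal kj)).
have N0N i : (N0 i <= N i)%N by exact: (@leq_bigmax _ (fun j : 'I_i.+1 => N0 j) ord_max).
have hN i n : (N i <= n)%N ->
    (L2sq (fun x => (fourier_sum f n x - fourier_sum f (N i) x)%R) <= (d i)%:E)%E.
  move=> nN; rewrite L2sq_fourier_sumB// lee_fin mulrC -ler_pdivlMr ?mulr_gt0//.
  apply: le_trans (hN0 i n (leq_trans (N0N i) nN)); rewrite lerD2l lerN2.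
  exact: mW.
have cS := ccont_fourier_sum f; have mS n := ccont_measurable (cS n).
have [g mg hg] := @L2_fast_cauchy R (fun i => fourier_sum f (N i)) (fun i => cS (N i))
   (fun i j ij => hN i (N j) (NN i j ij)).
have mgS n : cmeasurable I (fun x => g x - fourier_sum f n x) by exact: cmeasurableB.
exists g; split => //.
- have -> : g = (fun x => (g x - fourier_sum f (N 0) x) + fourier_sum f (N 0) x).
    by apply/funext => x; rewrite subrK.
  apply: le_lt_trans (L2sqD _ _) _ => //.
  apply: lte_add_pinfty.
    by rewrite lte_mul_pinfty ?lee_fin//; exact: le_lt_trans (hg 0) (ltry _).
  by rewrite (L2sq_cont (cS _)) -EFinM ltry.
- apply/cvg0_eps => [n|e e0].
    by apply: integral_ge0 => x _; rewrite lee_fin sqr_ge0.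
  have [i hi] : exists i, 4 * d i <= e.
    have := near_infty_natSinv_lt (PosNum e0) => -[i _ /(_ i (leqnn i))] /= hi.
    exists i.+1; apply: le_trans (ltW hi); rewrite /d invfM mulrA.
    have -> : 4 / 2 = 2 :> R by field.
    rewrite ler_pdivrMr ?exprn_gt0// mulrC ler_pdivlMr//.
    rewrite -natrX -(natrM _ 2) ler_nat.
    elim: (i) => [|j ih]; first by [].
    by rewrite expnS; lia.
  exists (N i) => n nN; apply: le_trans (_ : (2%:E * (d i)%:E + 2%:E * (d i)%:E <= e%:E)%E); last first.
    by rewrite -!EFinM -EFinD lee_fin; lra.
  have -> : (fun x => ((cabs (g x - fourier_sum f n x) ^+ 2)%:E)) =
     (fun x => ((cabs ((g x - fourier_sum f (N i) x)
                       + (fourier_sum f (N i) x - fourier_sum f n x)) ^+ 2)%:E)).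
    by apply/funext => x; rewrite addrA subrK.
  apply: (le_trans (L2sqD _ _)); [by []|exact: cmeasurableB|].
  apply: leeD; (apply: lee_wpmul2l; first by rewrite lee_fin); first exact: hg.
  apply: le_trans (hN i n nN); rewrite /L2sq.
  by under eq_integral do rewrite cabsB.
Qed.

End FourierTransform.

(** * The matrix of a pseudo-differential operator *)

Section Representation.
Context {R : realType}.
Notation mu := (@lebesgue_measure R).
Notation I := `[- pi, pi]%classic.
Notation cint := (@cintegral R I).
Implicit Types (u v g h : R -> R[i]) (f : int -> R[i]).

(** The inequality [|h| <= d + |h| ^+ 2 / d] takes the place of Cauchy-Schwarz, and it
    also proves that the product is integrable. *)
Lemma pairing_bound u h (M : R) : ccont u -> (forall x, cabs (u x) <= M) ->
  cmeasurable I h -> (L2sq h < +oo)%E ->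
  cintegrable (fun x => u x * h x) /\
  forall d : R, 0 < d ->
    cabs (cint (fun x => u x * h x)) <= 2 * (M * (2 * pi * d + fine (L2sq h) / d)).
Proof.
move=> cu uM mh fh.
have M0 : 0 <= M by apply: le_trans (uM 0); exact: cabs_ge0.
have ih : mu.-integrable I (fun x => (cabs (h x) ^+ 2)%:E).
  apply/integrableP; split; first exact: cmeasurable_sqr.
  by under eq_integral => x _ do rewrite gee0_abs ?lee_fin ?sqr_ge0//.
pose G (d x : R) := (M * d) + (M / d) * cabs (h x) ^+ 2.
have iG d : mu.-integrable I (fun x => (G d x)%:E).
  apply: integrable_RD; last exact: integrable_RZ.
  by apply: (@integrable_cont _ (fun=> M * d)) => x; exact: cvg_cst.
have hG d x : 0 < d -> cabs (u x * h x) <= G d x.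
  move=> d0; rewrite cabsM /G -mulrA -mulrDr; apply: ler_pM; rewrite ?cabs_ge0//.
  have [hd|dh] := leP (cabs (h x)) d.
    by rewrite -[leLHS]addr0 lerD// mulr_ge0// ?sqr_ge0// invr_ge0 ltW.
  rewrite -[leLHS]add0r lerD// ?(ltW d0)// mulrC ler_pdivlMr// expr2 ler_wpM2l ?cabs_ge0//.
  exact: ltW.
have [m1 m2] := cmeasurableM (ccont_measurable cu) mh.
have iuh : cintegrable (fun x => u x * h x).
  split; apply: (le_integrable _ _ _ (iG 1)) => //.
  - exact/measurable_EFinP.
  - move=> x _; rewrite lee_fin; apply: le_trans (cRe_cabs _) _.
    exact: le_trans (hG 1 x ltr01) (ler_norm _).
  - exact/measurable_EFinP.
  - move=> x _; rewrite lee_fin; apply: le_trans (cIm_cabs _) _.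
    exact: le_trans (hG 1 x ltr01) (ler_norm _).
split => // d d0; apply: le_trans (@cabs_cintegral _ _ (G d) iuh (iG d) _) _.
  by move=> x _; exact: hG.
rewrite ler_pM2l// RintegralD//; last 2 first.
- by apply: (@integrable_cont _ (fun=> M * d)) => x; exact: cvg_cst.
- exact: integrable_RZ.
rewrite Rintegral_cstI RintegralZl// /L2sq /Rintegral.
by rewrite le_eqVlt; apply/orP; left; apply/eqP; field; rewrite gt_eqF.
Qed.

Definition symbol_matrix (sigma : int -> R -> R[i]) (k l : int) : R[i] :=
  ((2 * pi)^-1)%:C * coef (sigma k) (l - k).

(** The rows are summed along symmetric windows, because that is how [fourier_sum]
    converges. *)
Definition matrix_operator (T : (int -> R[i]) -> int -> R[i]) (A : int -> int -> R[i]) :=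
  forall f, l2 f -> forall k (e : R), 0 < e -> exists N0, forall N, (N0 <= N)%N ->
    cabs (T f k - \sum_(l <- window N) A k l * f l) <= e.

(** On a partial Fourier sum of [f] the integral over a period splits into Fourier
    coefficients of [sigma k], which are the entries of the matrix. The error is the
    integral of a bounded function against a function that tends to 0 in square
    mean. *)
Lemma pseudo_diff_matrix (sigma : int -> R -> R[i]) :
  (forall k, ccont (sigma k)) -> (forall k, exists M : R, forall x, cabs (sigma k x) <= M) ->
  matrix_operator (pseudo_diff sigma) (symbol_matrix sigma).
Proof.
move=> cs bs f lf k e e0; have p0 := @pi_gt0 R.
have [mF fF cF] : is_fourier_transform f (fourier_transform f).
  exact: xgetPex (fourier_transform_ex lf).
set F := fourier_transform f in mF fF cF *.
have [M sM] := bs k; pose u x := expi (k%:~R * x) * sigma k x.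
have cu : ccont u.
  apply: ccontM => //; rewrite (_ : (fun x => _) = fun x => expi (k%:~R * x + 0)).
    exact: ccont_expi.
  by apply/funext => x; rewrite addr0.
have uM x : cabs (u x) <= M by rewrite cabsM cabs_expi mul1r.
have M0 : 0 <= M by apply: le_trans (sM 0); exact: cabs_ge0.
have cS := ccont_fourier_sum f.
pose d := e / (4 * (M + 1) * (2 * pi + 1)).
have q0 : 0 < 2 * pi + 1 :> R by rewrite ltr_wpDl// mulr_ge0// ltW.
have M10 : 0 < M + 1 by rewrite ltr_wpDl.
have d0 : 0 < d by rewrite divr_gt0// !mulr_gt0.
have a0 n : (0 <= \int[mu]_(x in I) ((cabs (F x - fourier_sum f n x) ^+ 2)%:E))%E.
  by apply: integral_ge0 => x _; rewrite lee_fin sqr_ge0.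
have [N0 hN0] := (cvg0_eps a0).1 cF (d ^+ 2) (exprn_gt0 2 d0).
exists N0 => N /hN0 hN.
have mB : cmeasurable I (fun x => F x - fourier_sum f N x).
  exact/cmeasurableB/ccont_measurable.
have fB : (L2sq (fun x => (F x - fourier_sum f N x)%R) < +oo)%E.
  exact: le_lt_trans hN (ltry _).
have [i1 _] := pairing_bound cu uM mF fF.
have [i2 h2] := pairing_bound cu uM mB fB.
have i3 : cintegrable (fun x => u x * fourier_sum f N x).
  exact/ccont_integrable/ccontM.
have eS : cint (fun x => u x * fourier_sum f N x) =
    \sum_(l <- window N) f l * coef (sigma k) (l - k).
  rewrite (_ : (fun x => _) = fun x =>
      \sum_(l <- window N) (f l * (sigma k x * expi (- ((l - k)%:~R * x))))).
    rewrite cintegral_sum; last first.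
      by move=> l; apply: ccontM; [exact: ccont_cst|apply: ccontM => //; exact: ccont_char].
    apply: eq_bigr => l _; rewrite cintegralZ//.
    by apply/ccont_integrable/ccontM => //; exact: ccont_char.
  apply/funext => x; rewrite fourier_sumE mulr_sumr; apply: eq_bigr => l _.
  rewrite /u (_ : - ((l - k)%:~R * x) = k%:~R * x + - (l%:~R * x)); last by rewrite intrB; ring.
  by rewrite expiD; ring.
have eD : cint (fun x => u x * F x) = cint (fun x => u x * (F x - fourier_sum f N x))
    + cint (fun x => u x * fourier_sum f N x).
  rewrite -cintegralD//; congr cintegral; apply/funext => x.
  by rewrite -mulrDr subrK.
have -> : pseudo_diff sigma f k - \sum_(l <- window N) symbol_matrix sigma k l * f l =
   ((2 * pi)^-1)%:C * cint (fun x => u x * (F x - fourier_sum f N x)).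
  rewrite /pseudo_diff -/F -[cintegral _ _]/(cint (fun x => u x * F x)) eD eS mulrDr -addrA.
  rewrite [Y in _ + Y](_ : _ = 0) ?addr0//; apply/eqP; rewrite subr_eq0; apply/eqP.
  by rewrite mulr_sumr; apply: eq_bigr => l _; rewrite /symbol_matrix; ring.
rewrite cabsM cabs_real ger0_norm; last by rewrite invr_ge0 mulr_ge0// ltW.
have h3 : fine (L2sq (fun x => (F x - fourier_sum f N x)%R)) <= d ^+ 2.
  rewrite -lee_fin fineK//; rewrite ge0_fin_numE//.
  by apply: integral_ge0 => x _; rewrite lee_fin sqr_ge0.
apply: le_trans (_ : 1 * cabs (cint (fun x => u x * (F x - fourier_sum f N x))) <= _).
  rewrite ler_wpM2r ?cabs_ge0// invf_le1 ?mulr_gt0//.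
  have := @pi_ge2 R; lra.
rewrite mul1r; apply: le_trans (h2 d d0) _.
apply: (@le_trans _ _ (2 * (M * (2 * pi * d + d)))).
  rewrite ler_pM2l// ler_wpM2l// lerD2l ler_pdivrMr// -expr2//.
rewrite (_ : 2 * pi * d + d = (2 * pi + 1) * d); last by ring.
have -> : 2 * (M * ((2 * pi + 1) * d)) = (M / (M + 1)) * (e / 2).
  rewrite /d; move: (2 * pi + 1) (M + 1) (lt0r_neq0 q0) (lt0r_neq0 M10) => q m q1 m1.
  by field; rewrite m1 q1.
apply: (@le_trans _ _ (1 * (e / 2))); last by lra.
apply: ler_wpM2r; first by rewrite divr_ge0// ltW.
by rewrite ler_pdivrMr// mul1r lerDl.
Qed.

(** Linearity cannot be read off the definition of [pseudo_diff], where a representative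
    of the Fourier transform is chosen for each sequence separately; it can be read
    off the matrix. *)
Lemma matrix_operator_linear T A : matrix_operator T A ->
  forall (a : R[i]) (f g : int -> R[i]), l2 f -> l2 g ->
  T (fun k => a * f k + g k) = (fun k => a * T f k + T g k).
Proof.
move=> TA a f g lf lg; apply/funext => k; apply/eqP; rewrite -subr_eq0.
apply/eqP/cabs_eq0/eqP; rewrite eq_le cabs_ge0 andbT.
apply/ler_addgt0Pl => e e0; rewrite addr0.
pose d := e / (cabs a + 2).
have a2 : 0 < cabs a + 2 by rewrite ltr_wpDl ?cabs_ge0.
have d0 : 0 < d by rewrite divr_gt0.
have [N1 h1] := TA _ (l2_lin a lf lg) k d d0.
have [N2 h2] := TA _ lf k d d0.
have [N3 h3] := TA _ lg k d d0.
pose N := (N1 + N2 + N3)%N.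
have {}h1 := h1 N (leq_trans (leq_addr _ _) (leq_addr _ _)).
have {}h2 := h2 N (leq_trans (leq_addl _ _) (leq_addr _ _)).
have {}h3 := h3 N (leq_addl _ _).
set S1 := (X in cabs (_ - X)) in h1; set S2 := (X in cabs (_ - X)) in h2.
set S3 := (X in cabs (_ - X)) in h3.
have SE : S1 = a * S2 + S3.
  rewrite /S1 /S2 /S3 mulr_sumr -big_split /=; apply: eq_bigr => l _; ring.
rewrite (_ : _ - _ = (T (fun j => a * f j + g j) k - S1)
    + (- (a * (T f k - S2)) - (T g k - S3))); last first.
  by rewrite SE; ring.
apply: le_trans (cabsD _ _) _; apply: le_trans (lerD h1 (cabsD _ _)) _.
rewrite !cabsN cabsM.
apply: (@le_trans _ _ (d + (cabs a * d + d))).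
  by rewrite lerD2l; apply: lerD => //; rewrite ler_wpM2l ?cabs_ge0.
rewrite /d le_eqVlt; apply/orP; left; apply/eqP; field; rewrite gt_eqF//.
Qed.

Definition delta (l : int) : int -> R[i] := fun k => if k == l then 1 else 0.

Lemma sum_delta (l : int) (V : zmodType) (a : int -> V) (s : seq int) : uniq s ->
  \sum_(k <- s) (if k == l then a k else 0) = if l \in s then a l else 0.
Proof.
move=> us; case: ifPn => ls; last first.
  rewrite big_seq big1// => k ks; case: eqP => // kl; by rewrite -kl ks in ls.
by rewrite (bigD1_seq l)//= eqxx big1 ?addr0// => k /negbTE ->.
Qed.

Lemma delta_norm l N : \sum_(k <- window N) cabs (delta l k) ^+ 2 <= 1 :> R.
Proof.
rewrite (eq_bigr (fun k => if k == l then 1 else 0)); last first.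
  by move=> k _; rewrite /delta; case: ifP => _; rewrite ?cabs1 ?cabs0 ?expr1n ?expr0n.
by rewrite (sum_delta l (fun=> 1)) ?uniq_window//; case: ifP.
Qed.

Lemma matrix_operator_delta T A k l : matrix_operator T A -> T (delta l) k = A k l.
Proof.
move=> TA; apply/eqP; rewrite -subr_eq0; apply/eqP/cabs_eq0/eqP; rewrite eq_le cabs_ge0 andbT.
apply/ler_addgt0Pl => e e0; rewrite addr0.
have ld : l2 (delta l) by apply/l2P; exists 1 => N; exact: delta_norm.
have [N0 /(_ (N0 + `|l|)%N (leq_addr _ _))] := TA _ ld k e e0.
rewrite (eq_bigr (fun j => if j == l then A k j else 0)); last first.
  by move=> j _; rewrite /delta; case: ifP => _; rewrite ?mulr1 ?mulr0.
by rewrite sum_delta ?uniq_window// mem_window leq_addl.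
Qed.

End Representation.

(** * Schur's test with a translation-invariant weight *)

Section Schur.
Context {R : realType}.
Implicit Types (f g h : int -> R[i]).

Definition psi (m : int) : R := m%:~R / (1 + `|m%:~R|).
(** The increments of a bounded increasing function have a bounded sum along any run
    of consecutive integers, in either direction; these decay like [|m| ^- 2]. *)
Definition weight (m : int) : R := psi (m + 1) - psi m.

Lemma psi_bound m : `|psi m| <= 1.
Proof.
rewrite /psi normrM normfV (ger0_norm (_ : 0 <= 1 + _)) ?addr_ge0//.
by rewrite ler_pdivrMr ?ltr_pwDl// mul1r lerDr.
Qed.

(** The formula shows the symmetry of the weight about -1/2, and covers both signs
    of [m]. *)
Lemma weightE m : weight m = ((`|m%:~R + 2^-1| + 2^-1) * (`|m%:~R + 2^-1| + 3 / 2))^-1.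
Proof.
rewrite /weight /psi; case: m => n.
  rewrite (_ : (Posz n + 1)%:~R = n%:R + 1 :> R); last by rewrite intrD.
  rewrite (_ : (Posz n)%:~R = n%:R :> R)//.
  have n0 : 0 <= n%:R :> R by [].
  rewrite !ger0_norm; [|lra..].
  by field; rewrite !gt_eqF//; lra.
rewrite NegzE (_ : (- n.+1%:Z + 1)%:~R = - n%:R :> R); last first.
  by rewrite intrD mulrNz -[n.+1]addn1 PoszD intrD; ring.
rewrite (_ : (- n.+1%:Z)%:~R = - (n%:R + 1) :> R); last by rewrite mulrNz natr1.
have n0 : 0 <= n%:R :> R by [].
move: (n%:R : R) n0 => t t0.
have -> : `|- t| = t by rewrite normrN ger0_norm.
have -> : `|- (t + 1)| = t + 1 by rewrite normrN ger0_norm//; lra.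
have -> : `|- (t + 1) + 2^-1| = t + 2^-1 by rewrite ler0_norm; lra.
by field; rewrite !gt_eqF//; lra.
Qed.

Lemma weight_gt0 m : 0 < weight m.
Proof. by rewrite weightE invr_gt0 mulr_gt0// ltr_wpDl// divr_gt0. Qed.

(** The constant comes from [(1 + t) * (2 + t) <= 4 * (1 + t ^+ 2)] and
    [(1 + t ^+ 2) ^+ 2 <= 2 * (1 + t ^+ 4)]. *)
Lemma weight_decay m (a C : R) : 0 <= a -> a * (1 + `|m%:~R| ^+ 4) <= C ->
  a <= 32 * C * weight m ^+ 2.
Proof.
move=> a0 aC; rewrite weightE exprVn ler_pdivlMr; last first.
  by rewrite exprn_gt0// mulr_gt0// ltr_wpDl// divr_gt0.
apply: le_trans (_ : a * (32 * (1 + `|m%:~R| ^+ 4)) <= _); last first.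
  by rewrite mulrCA ler_pM2l.
apply: ler_wpM2l => //.
have : `|m%:~R + 2^-1| <= `|m%:~R| + 2^-1 :> R.
  by apply: le_trans (ler_normD _ _) _; rewrite lerD2l ger0_norm.
set t := `|m%:~R|; set r := `|_ + _| => rt.
have t0 : 0 <= t by exact: normr_ge0. have r0 : 0 <= r by exact: normr_ge0.
have h1 : (r + 2^-1) * (r + 3 / 2) <= (t + 1) * (t + 2).
  by apply: ler_pM; lra.
have h2 : (t + 1) * (t + 2) <= 4 * (1 + t ^+ 2).
  by rewrite expr2; have := sqr_ge0 (t - 2^-1); rewrite expr2; lra.
apply: (@le_trans _ _ ((4 * (1 + t ^+ 2)) ^+ 2)).
  have p1 : 0 <= (r + 2^-1) * (r + 3 / 2) by apply: mulr_ge0; lra.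
  have p2 : 0 <= 4 * (1 + t ^+ 2) by rewrite mulr_ge0// addr_ge0// sqr_ge0.
  by rewrite ler_pXn2r ?nnegrE//; exact: le_trans h1 h2.
have := sqr_ge0 (t ^+ 2 - 1); rewrite (_ : t ^+ 4 = t ^+ 2 * t ^+ 2); last by ring.
by rewrite !expr2; lra.
Qed.

Lemma sum_weight_col N k : \sum_(l <- window N) weight (l - k) <= 2.
Proof.
rewrite /window big_map.
rewrite (eq_bigr (fun j : nat => psi (j.+1%:Z - N%:Z - k) - psi (j%:Z - N%:Z - k))); last first.
  by move=> j _; rewrite /weight (_ : _ + 1 = j.+1%:Z - N%:Z - k)//; lia.
rewrite telescope_sumr//.
apply: le_trans (ler_norm _) (le_trans (ler_normB _ _) _).
by rewrite -[2]/(1 + 1); apply: lerD; exact: psi_bound.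
Qed.

Lemma sum_weight_row N l : \sum_(k <- window N) weight (l - k) <= 2.
Proof.
rewrite /window big_map.
rewrite (eq_bigr (fun j : nat =>
    (- psi (l - j.+1%:Z + N%:Z + 1)) - (- psi (l - j%:Z + N%:Z + 1)))); last first.
  move=> j _; rewrite /weight opprK (_ : l - (j%:Z - N%:Z) = l - j.+1%:Z + N%:Z + 1); last by lia.
  by rewrite (_ : _ + 1 + 1 = l - j%:Z + N%:Z + 1) 1?addrC//; lia.
rewrite telescope_sumr//.
apply: le_trans (ler_norm _) (le_trans (ler_normB _ _) _).
by rewrite !normrN -[2]/(1 + 1); apply: lerD; exact: psi_bound.
Qed.

(** Expand the nonnegative sum of the [w i * (x i - P / 2) ^+ 2], where [P] is the sum of
    the [w i * x i]. The number [P / 2] stands for the mean, so that one need not divide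
    by the total weight. *)
Lemma weighted_jensen (J : Type) (s : seq J) (w x : J -> R) :
  (forall i, 0 <= w i) -> \sum_(i <- s) w i <= 2 ->
  (\sum_(i <- s) w i * x i) ^+ 2 <= 2 * \sum_(i <- s) w i * x i ^+ 2.
Proof.
move=> w0 w2; set P := \sum_(i <- s) w i * x i.
have h : 0 <= \sum_(i <- s) w i * (x i - P / 2) ^+ 2.
  by apply: sumr_ge0 => i _; rewrite mulr_ge0// sqr_ge0.
have e : \sum_(i <- s) w i * (x i - P / 2) ^+ 2 =
    \sum_(i <- s) w i * x i ^+ 2 - P ^+ 2 + P ^+ 2 / 4 * \sum_(i <- s) w i.
  have -> : P ^+ 2 = P * \sum_(i <- s) w i * x i by rewrite -/P expr2.
  rewrite (_ : P * _ / 4 = P ^+ 2 / 4); last by rewrite -/P expr2.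
  by rewrite !mulr_sumr -sumrB -big_split /=; apply: eq_bigr => i _; field.
rewrite e in h.
have : P ^+ 2 / 4 * \sum_(i <- s) w i <= P ^+ 2 / 4 * 2.
  by apply: ler_wpM2l => //; rewrite divr_ge0// sqr_ge0.
move: h; move: (P ^+ 2) (\sum_(i <- s) w i * _) (_ / 4 * \sum_(i <- s) w i) => p q r.
lra.
Qed.

Lemma matrix_operator_cvg T A f k : matrix_operator T A -> l2 f ->
  (fun N => cabs (\sum_(l <- window N) A k l * f l) ^+ 2) @ \oo --> cabs (T f k) ^+ 2.
Proof.
move=> TA lf; rewrite !expr2.
suff h : (fun N => cabs (\sum_(l <- window N) A k l * f l)) @ \oo --> cabs (T f k).
  by under eq_fun do rewrite expr2; exact: cvgM.
apply/cvgrPdist_le => e e0; have [N0 hN] := TA _ lf k e e0.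
exists N0 => // N /hN /=; apply: le_trans.
set a := T f k; set b := \sum_(_ <- _) _.
have h1 := cabsD (a - b) b; have h2 := cabsD (b - a) a.
rewrite !subrK in h1 h2; rewrite (cabsB b) in h2.
by rewrite ler_norml; apply/andP; split; lra.
Qed.

Lemma cvg_sum_seq (T J : Type) (U : set_system T) (FU : Filter U) (s : seq J)
    (F : J -> T -> R) (l : J -> R) :
  (forall j, F j @ U --> l j) -> (fun t => \sum_(j <- s) F j t) @ U --> \sum_(j <- s) l j.
Proof.
move=> h; elim: s => [|j s ih].
  under eq_fun do rewrite big_nil; rewrite big_nil; exact: cvg_cst.
under eq_fun do rewrite big_cons; rewrite big_cons; apply: cvgD => //; exact: h.
Qed.

(** [weighted_jensen] in each row, then exchange of the summations over rows and
    columns. This is done for truncated rows, where all sums are finite, and the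
    truncation is removed at the end, in finitely many rows at a time. Restricting to
    the rows in [P] is what separates the tail of [T f] from the rest. *)
Lemma schur_bound T A (s : int -> R) (P : pred int) (S B : R) f :
  matrix_operator T A ->
  (forall k l, cabs (A k l) ^+ 2 <= s k * weight (l - k) ^+ 2) ->
  0 <= S -> (forall k, P k -> s k <= S) ->
  (forall N, \sum_(l <- window N) cabs (f l) ^+ 2 <= B) ->
  forall K, \sum_(k <- window K | P k) cabs (T f k) ^+ 2 <= 4 * S * B.
Proof.
move=> TA hA S0 sS fB K; have lf : l2 f by apply/l2P; exists B.
have w0 m : 0 <= weight m by rewrite ltW// weight_gt0.
rewrite -big_filter; set r := [seq k <- window K | P k].
pose X N k := cabs (\sum_(l <- window N) A k l * f l) ^+ 2.
have cX : (fun N => \sum_(k <- r) X N k) @ \oo --> \sum_(k <- r) cabs (T f k) ^+ 2.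
  by apply: cvg_sum_seq => k; exact: matrix_operator_cvg.
apply: (cvgr_to_le cX); apply: nearW => N.
apply: (@le_trans _ _ (\sum_(k <- window K)
    2 * S * \sum_(l <- window N) weight (l - k) * cabs (f l) ^+ 2)).
  rewrite /r big_filter [leRHS](bigID P) /= -[leLHS]addr0; apply: lerD; last first.
    apply: sumr_ge0 => k _; rewrite !mulr_ge0// sumr_ge0// => l _.
    by rewrite mulr_ge0// sqr_ge0.
  apply: ler_sum => k Pk; rewrite /X.
  apply: (@le_trans _ _ ((Num.sqrt S * \sum_(l <- window N) weight (l - k) * cabs (f l)) ^+ 2)).
    rewrite ler_pXn2r ?nnegrE ?cabs_ge0//; last first.
      by rewrite mulr_ge0 ?sqrtr_ge0// sumr_ge0// => l _; rewrite mulr_ge0 ?cabs_ge0.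
    apply: le_trans (cabs_sum _ _ _) _; rewrite mulr_sumr; apply: ler_sum => l _.
    rewrite cabsM mulrA; apply: ler_wpM2r; first exact: cabs_ge0.
    rewrite -(@ler_pXn2r _ 2) ?nnegrE ?cabs_ge0 ?mulr_ge0 ?sqrtr_ge0//.
    apply: (le_trans (hA k l)); rewrite exprMn sqr_sqrtr// ler_wpM2r ?sqr_ge0//.
    exact: sS.
  rewrite exprMn sqr_sqrtr// (mulrC 2 S) -mulrA.
  apply: ler_wpM2l => //; apply: weighted_jensen => [l|]; first exact: w0.
  exact: sum_weight_col.
rewrite -mulr_sumr exchange_big /=.
apply: (@le_trans _ _ (2 * S * (2 * B))); last first.
  by rewrite le_eqVlt; apply/orP; left; apply/eqP; ring.
apply: ler_wpM2l; first by rewrite mulr_ge0.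
apply: (@le_trans _ _ (\sum_(l <- window N) 2 * cabs (f l) ^+ 2)).
  apply: ler_sum => l _; rewrite -mulr_suml; apply: ler_wpM2r; first exact: sqr_ge0.
  exact: sum_weight_row.
by rewrite -mulr_sumr ler_pM2l.
Qed.

End Schur.

(** * Relative compactness in l^2 and the limit superior *)

Section Compactness.
Context {R : realType}.
Notation I := `[- pi, pi]%classic.
Implicit Types (f h : int -> R[i]).

Lemma sum_window_point f (B : R) k : (forall N, \sum_(l <- window N) cabs (f l) ^+ 2 <= B) ->
  cabs (f k) ^+ 2 <= B.
Proof.
move=> /(_ `|k|%N); apply: le_trans; rewrite (bigD1_seq k) ?uniq_window ?mem_window//=.
by rewrite lerDl; apply: sumr_ge0 => l _; exact: sqr_ge0.
Qed.

Lemma l2norm_point f k (e : R) : 0 <= e -> (l2norm f <= e%:E)%E -> cabs (f k) <= e.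
Proof.
move=> e0 /(l2norm_leP _ e0) /(sum_window_point k).
by rewrite ler_pXn2r ?nnegrE ?cabs_ge0.
Qed.

Lemma cabs_cvg_sqr (U : set_system nat) (FU : Filter U) (g : nat -> R[i]) (z w : R[i]) :
  (fun n => cRe (g n)) @ U --> cRe z -> (fun n => cIm (g n)) @ U --> cIm z ->
  (fun n => cabs (g n - w) ^+ 2) @ U --> cabs (z - w) ^+ 2.
Proof.
move=> hr hi; rewrite sqr_cabs cReD cImD cReN cImN.
rewrite (_ : (fun n => _) = fun n => (cRe (g n) - cRe w) * (cRe (g n) - cRe w)
   + (cIm (g n) - cIm w) * (cIm (g n) - cIm w)).
  rewrite !expr2; apply: cvgD; apply: cvgM; apply: cvgB; do ?[exact: cvg_cst].
  exact: hr. exact: hr. exact: hi. exact: hi.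
by apply/funext => n; rewrite sqr_cabs cReD cImD cReN cImN !expr2.
Qed.

(** A cluster point is a limit, because an ultrafilter contains the inverse image of
    each neighbourhood or the complement of that image. *)
Lemma ultra_cvg_bounded (U : set_system nat) (UU : UltraFilter U) (p : nat -> R) (c : R) :
  (forall n, `|p n| <= c) -> exists l : R, p @ U --> l.
Proof.
move=> pc; have FU : ProperFilter U by exact: ultra_proper.
have [|l [_ hl]] := @segment_compact R (- c) c (p @ U) _.
  by apply: nearW => n; rewrite /= in_itv /= -ler_norml; exact: pc.
exists l => V lV; have [//|Vc] := in_ultra_setVsetC (p @^-1` V) UU.
have [y [Vcy Vy]] := hl (~` V) V Vc lV.
by [].
Qed.

(** Along an ultrafilter that refines the tails of the natural numbers all coordinates
    converge at once. The uniform smallness of the tails turns this into convergence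
    in norm along the ultrafilter, and a subsequence is extracted because the members
    of the ultrafilter meet every tail. *)
Lemma tight_compact (g : nat -> int -> R[i]) (B : R) :
  (forall n N, \sum_(k <- window N) cabs (g n k) ^+ 2 <= B) ->
  (forall e : R, 0 < e -> exists N0 : nat, forall n K,
     \sum_(k <- window K | (N0 <= `|k|)%N) cabs (g n k) ^+ 2 <= e) ->
  exists (phi : nat -> nat) (h : int -> R[i]),
    [/\ {homo phi : m n / (m < n)%N}, l2 h &
        (fun n => l2norm (fun k => g (phi n) k - h k)) @ \oo --> 0%E].
Proof.
move=> gB gT; have [U [UU oU]] := ultraFilterLemma (F := \oo) _.
have [h hh] : {h : int -> R[i] & forall k, (fun n => cRe (g n k)) @ U --> cRe (h k) /\
    (fun n => cIm (g n k)) @ U --> cIm (h k)}.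
  apply: (@boolp.choice _ _ (fun k z => (fun n => cRe (g n k)) @ U --> cRe z /\
    (fun n => cIm (g n k)) @ U --> cIm z)) => k.
  have b n : cabs (g n k) <= Num.sqrt B.
    have Bk := sum_window_point k (gB n).
    rewrite -(@ler_pXn2r _ 2) ?nnegrE ?cabs_ge0 ?sqrtr_ge0// sqr_sqrtr//.
    exact: le_trans (sqr_ge0 _) Bk.
  have [a ha] := ultra_cvg_bounded UU (fun n => le_trans (cRe_cabs _) (b n)).
  have [a' ha'] := ultra_cvg_bounded UU (fun n => le_trans (cIm_cabs _) (b n)).
  by exists (a +i* a').
have FU : ProperFilter U by exact: ultra_proper.
have hs (s : seq int) (c : R) : (forall n, \sum_(k <- s) cabs (g n k) ^+ 2 <= c) ->
    \sum_(k <- s) cabs (h k) ^+ 2 <= c.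
  move=> gc; have hc :
      (fun n => \sum_(k <- s) cabs (g n k) ^+ 2) @ U --> \sum_(k <- s) cabs (h k) ^+ 2.
    apply: cvg_sum_seq => k; have [h1 h2] := hh k.
    have : (fun n => cabs (g n k - 0) ^+ 2) @ U --> cabs (h k - 0) ^+ 2 by exact: cabs_cvg_sqr.
    by under eq_fun do rewrite subr0; rewrite subr0.
  by apply: (cvgr_to_le hc); apply: nearW.
have hU (e : R) : 0 < e ->
    U [set n | forall K, \sum_(k <- window K) cabs (g n k - h k) ^+ 2 <= e].
  move=> e0; have e8 : 0 < e / 8 by rewrite divr_gt0.
  have [N0 hN0] := gT _ e8.
  have hc : (fun n => \sum_(k <- window N0) cabs (g n k - h k) ^+ 2) @ U -->
      \sum_(k <- window N0) cabs (h k - h k) ^+ 2.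
    apply: cvg_sum_seq => k; have [h1 h2] := hh k; exact: cabs_cvg_sqr.
  rewrite big1 in hc; last by move=> k _; rewrite subrr cabs0 expr0n.
  have e2 : 0 < e / 2 by rewrite divr_gt0.
  move/cvgrPdist_le : hc => /(_ _ e2); apply: filterS => n /=.
  rewrite sub0r normrN ger0_norm; last by apply: sumr_ge0 => k _; exact: sqr_ge0.
  move=> hn K; rewrite (bigID (fun k => (N0 <= `|k|)%N)) /=.
  rewrite (_ : e = e / 2 + e / 2); last by field.
  apply: lerD; last first.
    apply: le_trans hn; rewrite -big_filter; apply: sum_sub_uniq.
    - exact/filter_uniq/uniq_window.
    - exact: uniq_window.
    - by move=> k; rewrite mem_filter !mem_window -ltnNge => /andP[/ltnW].
    - by move=> k; exact: sqr_ge0.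
  apply: (@le_trans _ _ (\sum_(k <- window K | (N0 <= `|k|)%N)
      (2 * cabs (g n k) ^+ 2 + 2 * cabs (h k) ^+ 2))).
    apply: ler_sum => k _; apply: le_trans (sqr_cabsD _ _) _.
    by rewrite cabsN.
  rewrite big_split /= -!mulr_sumr.
  have t1 := hN0 n K.
  have t2 : \sum_(k <- window K | (N0 <= `|k|)%N) cabs (h k) ^+ 2 <= e / 8.
    by rewrite -big_filter; apply: hs => j; rewrite big_filter; exact: hN0.
  lra.
(* One step of the extraction: the [j]-th term beyond the index [m]. *)
have ex j m : exists n, (m < n)%N /\
    forall K, \sum_(k <- window K) cabs (g n k - h k) ^+ 2 <= j.+1%:R^-1.
  have h1 : U [set n | (m < n)%N] by apply: oU; exists m.+1.
  have j0 : 0 < j.+1%:R^-1 :> R by rewrite invr_gt0.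
  by have [n [mn hn]] := @filter_ex _ U FU _ (filterI h1 (hU _ j0)); exists n.
have [sel hsel] : {sel : nat * nat -> nat & forall p, (p.2 < sel p)%N /\
    forall K, \sum_(k <- window K) cabs (g (sel p) k - h k) ^+ 2 <= p.1.+1%:R^-1}.
  by apply: (@boolp.choice _ _ (fun p n => (p.2 < n)%N /\
     forall K, \sum_(k <- window K) cabs (g n k - h k) ^+ 2 <= p.1.+1%:R^-1)) => p; exact: ex.
pose phi := fix phi j := if j is i.+1 then sel (j, phi i) else sel (0%N, 0%N).
have hphi j K : \sum_(k <- window K) cabs (g (phi j) k - h k) ^+ 2 <= j.+1%:R^-1.
  by case: j => [|j]; apply: (hsel (_, _)).2.
exists phi, h; split.
- by apply: homo_ltn => [|j]; [exact: ltn_trans|exact: (hsel (_, _)).1].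
- by apply/l2P; exists B => N; apply: hs => n; exact: gB.
- apply/cvg0_eps => [n|e e0]; first exact: poweR_ge0.
  have [N _ hN] := near_infty_natSinv_lt (PosNum (exprn_gt0 2 e0)).
  exists N => n nN; apply/l2norm_leP => [|K]; first exact: ltW.
  exact: le_trans (hphi n K) (ltW (hN n nN)).
Qed.

Lemma limsup_symbol0P (sigma : int -> R -> R[i]) :
  limsup_symbol sigma = 0%E <-> (forall e : R, 0 < e -> exists N : nat, forall k, (N <= `|k|)%N ->
    forall x, I x -> cabs (sigma k x) <= e).
Proof.
have p0 := @pi_ge0 R.
rewrite /limsup_symbol; set S := (X in ereal_inf X); split=> [S0 e e0|h].
  have [_ [N _ <-] hN] : exists2 x, S x & (x < e%:E)%E.
    by apply: ereal_inf_lt; rewrite S0 lte_fin.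
  exists N => k Nk x Ix; rewrite -lee_fin; apply: le_trans (ltW hN).
  apply: le_trans (ereal_sup_ubound _); last by exists k.
  by apply: ereal_sup_ubound; exists x.
apply/eqP; rewrite eq_le; apply/andP; split.
  apply/lee_addgt0Pr => e e0; rewrite add0e; have [N hN] := h e e0.
  apply: le_trans (_ : ereal_sup [set ereal_sup [set (cabs (sigma k x))%:E | x in I]
      | k in [set k : int | (N <= `|k|)%N]] <= _)%E.
    by apply: ereal_inf_lbound; exists N.
  apply: ge_ereal_sup => _ [k Nk <-]; apply: ge_ereal_sup => _ [x Ix <-].
  by rewrite lee_fin; exact: hN.
apply: le_ereal_inf_tmp => _ [N _ <-].
apply: (@le_trans _ _ (cabs (sigma N%:Z 0))%:E); first by rewrite lee_fin cabs_ge0.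
apply: le_trans (_ : ereal_sup [set (cabs (sigma N%:Z x))%:E | x in I] <= _)%E.
  by apply: ereal_sup_ubound; exists 0 => //=; rewrite in_itv /= oppr_le0 p0.
by apply: ereal_sup_ubound; exists N%:Z => /=.
Qed.

End Compactness.

(** * Compactness of pseudo-differential operators of order zero *)

Section Main.
Context {R : realType}.
Notation I := `[- pi, pi]%classic.
Implicit Types (sigma : int -> R -> R[i]).

(** The symbol estimates of order 0 without differences in [k]: the exponent of the
    weight function is then 0, and the bounds are uniform in [k]. *)
Definition uniformly_smooth sigma :=
  [/\ forall k, period2pi (sigma k), forall k, csmooth (sigma k) &
      forall n, exists2 C : R, 0 < C & forall k x, cabs (cderive n (sigma k) x) <= C].

Lemma symbol_class_uniformly_smooth (Lam : int -> R) (rho : R) sigma :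
  symbol_class Lam rho 0 sigma -> uniformly_smooth sigma.
Proof.
move=> [ps ss bs]; split => // n; have [C C0 hC] := bs 0 n 0 isT.
exists C => // k x; have := hC k x; rewrite mulr0 subr0 powRr0 mulr1.
rewrite -[X in cabs X <= _ -> _]/(cderive n (fun y => k%:~R ^+ 0 * sigma k y) x).
by rewrite (_ : (fun y => _) = sigma k)//; apply/funext => y; rewrite expr0 mul1r.
Qed.

Lemma symbol_matrix_far sigma : uniformly_smooth sigma ->
  exists C : R, forall k l, `|(l - k)%:~R| * cabs (symbol_matrix sigma k l) <= C.
Proof.
move=> [ps ss bs]; have [C C0 hC] := bs 1; exists (2 * C) => k l.
have p0 := @pi_gt0 R.
have := coef_decay (l - k) (ss k) (ps k) (hC k); rewrite expr1 => h.
have c0 : 0 <= (2 * pi)^-1 :> R by rewrite invr_ge0 mulr_ge0// ltW.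
rewrite cabsM cabs_real (ger0_norm c0) mulrCA ler_pdivrMl ?mulr_gt0//.
by rewrite (_ : 2 * pi * (2 * C) = 4 * pi * C)//; ring.
Qed.

(** The square of an entry is the product of two bounds for it: one by the size of the
    symbol in its row, the other by the decay of order 4 off the diagonal that four
    integrations by parts give, uniformly in the row. *)
Lemma symbol_matrix_bound sigma : uniformly_smooth sigma ->
  exists2 D : R, 0 <= D & forall (s : int -> R),
    (forall k x, I x -> cabs (sigma k x) <= s k) ->
    forall k l, cabs (symbol_matrix sigma k l) ^+ 2 <= D * s k * weight (l - k) ^+ 2.
Proof.
move=> [ps ss bs]; have [C0 C00 h0] := bs 0; have [C4 C40 h4] := bs 4.
have p0 := @pi_gt0 R.
exists (2 * (32 * (2 * C0 + 2 * C4))) => [|s hs k l].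
  by rewrite !mulr_ge0// addr_ge0// mulr_ge0// ltW.
set a := cabs (symbol_matrix _ _ _).
have aE : a = cabs (coef (sigma k) (l - k)) / (2 * pi).
  by rewrite /a cabsM cabs_real ger0_norm 1?mulrC// invr_ge0 mulr_ge0// ltW.
have cs : ccont (sigma k) by rewrite -(cderive0 (sigma k)); exact: csmooth_cont.
have b M : cabs (coef (sigma k) (l - k)) <= 4 * pi * M -> a <= 2 * M.
  move=> h; rewrite aE ler_pdivrMr ?mulr_gt0//; apply: (le_trans h).
  by rewrite le_eqVlt; apply/orP; left; apply/eqP; ring.
have a1 : a <= 2 * s k by apply: b; apply: cabs_coef => // x; exact: hs.
have a2 : a <= 2 * C0.
  by apply: b; apply: cabs_coef => // x _; have := h0 k x; rewrite cderive0.
have a3 : `|(l - k)%:~R| ^+ 4 * a <= 2 * C4.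
  have := coef_decay (l - k) (ss k) (ps k) (h4 k).
  rewrite aE => h; rewrite mulrA ler_pdivrMr ?mulr_gt0//; apply: (le_trans h).
  by rewrite le_eqVlt; apply/orP; left; apply/eqP; ring.
have a0 : 0 <= a by exact: cabs_ge0.
have a4 : a <= 32 * (2 * C0 + 2 * C4) * weight (l - k) ^+ 2.
  by apply: weight_decay => //; rewrite mulrDr mulr1 (mulrC a (_ ^+ 4)) lerD.
rewrite expr2; apply: (le_trans (ler_pM a0 a0 a1 a4)).
by rewrite le_eqVlt; apply/orP; left; apply/eqP; ring.
Qed.

Lemma uniformly_smooth_matrix sigma : uniformly_smooth sigma ->
  matrix_operator (pseudo_diff sigma) (symbol_matrix sigma).
Proof.
move=> [ps ss bs]; apply: pseudo_diff_matrix => k.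
  by rewrite -(cderive0 (sigma k)); exact: csmooth_cont.
by have [C _ hC] := bs 0; exists C => x; have := hC k x; rewrite cderive0.
Qed.

(** [schur_bound] for all rows shows that the image of a bounded sequence is bounded;
    for the rows with [N <= |k|], where the symbol is small, it shows that the tails
    of the image are uniformly small. *)
Lemma compact_of_vanishing sigma : uniformly_smooth sigma -> limsup_symbol sigma = 0%E ->
  compact_operator_l2 (pseudo_diff sigma).
Proof.
move=> us /limsup_symbol0P hs; have TA := uniformly_smooth_matrix us.
have [D D0 hD] := symbol_matrix_bound us.
have [_ _ bs] := us; have [C0 C00 h0] := bs 0.
have global (f : int -> R[i]) B : (forall N, \sum_(l <- window N) cabs (f l) ^+ 2 <= B) ->
    forall K, \sum_(k <- window K) cabs (pseudo_diff sigma f k) ^+ 2 <= 4 * (D * C0) * B.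
  move=> fB; apply: (@schur_bound _ _ _ (fun=> D * C0) xpredT _ _ _ TA) => //.
    by apply: (hD (fun=> C0)) => k x _; have := h0 k x; rewrite cderive0.
  by rewrite mulr_ge0// ltW.
split.
- by move=> f /l2P[B fB]; apply/l2P; exists (4 * (D * C0) * B); exact: global.
- by move=> a f g lf lg; exact: (matrix_operator_linear TA).
move=> f_ [M hM]; pose B := `|M| ^+ 2.
have fB n : forall N, \sum_(l <- window N) cabs (f_ n l) ^+ 2 <= B.
  apply/l2norm_leP => //; apply: le_trans (hM n) _; rewrite lee_fin; exact: ler_norm.
have B0 : 0 <= B by exact: sqr_ge0.
apply: (@tight_compact _ (fun n => pseudo_diff sigma (f_ n)) (4 * (D * C0) * B)) => [n|e e0].
  exact: global.
pose e' := e / (4 * (D + 1) * (B + 1)).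
have D1 : 0 < D + 1 by rewrite ltr_wpDl.
have B1 : 0 < B + 1 by rewrite ltr_wpDl.
have e'0 : 0 < e' by rewrite divr_gt0// !mulr_gt0.
have [N hN] := hs e' e'0; exists N => n K.
pose s k := if (N <= `|k|)%N then e' else C0.
apply: (@le_trans _ _ (4 * (D * e') * B)).
  apply: (@schur_bound _ _ _ (fun k => D * s k) (fun k => (N <= `|k|)%N) _ _ _ TA) => //.
  - apply: hD => k x Ix; rewrite /s; case: ifPn => [Nk|_]; first exact: hN.
    by have := h0 k x; rewrite cderive0.
  - by rewrite mulr_ge0// ltW.
  - by move=> k Nk; rewrite /s Nk.
have -> : e = 4 * ((D + 1) * e') * (B + 1).
  rewrite /e'; move: (D + 1) (B + 1) (lt0r_neq0 D1) (lt0r_neq0 B1) => d b d1 b1.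
  by field; rewrite d1 b1.
have i1 : 0 <= 4 * (D * e') by rewrite mulr_ge0// mulr_ge0// ltW.
have i2 : 4 * (D * e') <= 4 * ((D + 1) * e') by rewrite ler_pM2l// ler_pM2r// lerDl.
by apply: ler_pM => //; rewrite lerDl.
Qed.

(** The images of the unit vectors are the columns of the matrix. The entries of a
    column in a fixed row tend to 0 as the column goes to infinity, so by compactness
    its norm does so along a subsequence. If the symbol did not tend to 0, then by
    [sup_le_coef] there would be rows arbitrarily far out with an entry at distance at
    most [n] from the diagonal that stays away from 0, and the columns through these
    entries would not tend to 0. *)
Lemma vanishing_of_compact sigma : uniformly_smooth sigma ->
  compact_operator_l2 (pseudo_diff sigma) -> limsup_symbol sigma = 0%E.
Proof.
move=> us [_ _ hT]; have TA := uniformly_smooth_matrix us; apply/limsup_symbol0P => e e0.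
have [ps ss bs] := us; have [C0 C00 h0] := bs 0; have [C1 C10 h1] := bs 1.
have [n [eta eta0 hsup]] := sup_le_coef C00 C10 e0.
have p0 := @pi_gt0 R.
apply: contrapT => /forallNP nN.
(* For each [N] a row [k] with [N <= |k|] and a large coefficient of frequency [m]. *)
have [km hkm] : {km : nat -> int * int & forall N : nat, [/\ (N <= `|(km N).1|)%N,
    (`|(km N).2| <= n)%N & eta < cabs (coef (sigma (km N).1) (km N).2)]}.
  apply: (@boolp.choice _ _ (fun N km => [/\ (N <= `|km.1|)%N,
    (`|km.2| <= n)%N & eta < cabs (coef (sigma km.1) km.2)])) => N.
  apply: contrapT => /forallNP nk; apply: (nN N) => k Nk.
  apply: (hsup _ (ss k) (ps k)) => [x|x|m mn]; first by have := h0 k x; rewrite cderive0.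
    exact: h1.
  by rewrite leNgt; apply/negP => lt; apply: (nk (k, m)).
pose l N : int := (km N).1 + (km N).2.
have dn : exists M : R, forall N, (l2norm (@delta R (l N)) <= M%:E)%E.
  by exists 1 => N; apply/l2norm_leP => // K; rewrite expr1n; exact: delta_norm.
have [phi [h [mphi _ ch]]] := hT (fun N => delta (l N)) dn.
move/cvg0_eps : ch => /(_ (fun N => poweR_ge0 _ _)) ch'.
have phige j : (j <= phi j)%N.
  by elim: j => [//|j ih]; apply: leq_ltn_trans ih (mphi _ _ _).
have [C hC] := symbol_matrix_far us.
(* The columns tend to 0 entrywise, so their limit in norm can only be 0. *)
have h00 k : h k = 0.
  apply/cabs_eq0/eqP; rewrite eq_le cabs_ge0 andbT; apply/ler_addgt0Pl => d d0; rewrite addr0.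
  have d2 : 0 < d / 2 by rewrite divr_gt0.
  have [N1 hN1] := ch' _ d2.
  pose N := (N1 + (n + `|k|) + (Num.bound (C / (d / 2))))%N.
  have N1N : (N1 <= N)%N by rewrite /N -addnA leq_addr.
  have := l2norm_point k (ltW d2) (hN1 N N1N); rewrite (matrix_operator_delta _ _ TA) => h2.
  have h3 : cabs (symbol_matrix sigma k (l (phi N))) <= d / 2.
    have [a1 a2 _] := hkm (phi N); have a3 := phige N.
    have far : (Num.bound (C / (d / 2)) <= `|l (phi N) - k|)%N by rewrite /l; lia.
    have A0 : 0 <= C by apply: le_trans (hC k (l (phi N))); rewrite mulr_ge0// cabs_ge0.
    have bd : C < (Num.bound (C / (d / 2)))%:R * (d / 2).
      by rewrite -ltr_pdivrMr//; apply: archi_boundP; rewrite divr_ge0// ltW.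
    have farR : (Num.bound (C / (d / 2)))%:R <= `|(l (phi N) - k)%:~R| :> R.
      by rewrite -intr_norm -abszE -[leRHS]/((`|l (phi N) - k|%N)%:R) ler_nat.
    rewrite leNgt; apply/negP => lt; have := lt_le_trans bd (ler_wpM2r (ltW d2) farR).
    rewrite ltNge => /negP; apply; apply: le_trans (hC k (l (phi N))).
    by rewrite ler_wpM2l// ltW.
  have := cabsD (symbol_matrix sigma k (l (phi N))) (- (symbol_matrix sigma k (l (phi N)) - h k)).
  by rewrite cabsN opprB addrC subrK => h4; apply: (le_trans h4); rewrite [leRHS]splitr lerD.
have d0 : 0 < eta / (4 * pi) by rewrite divr_gt0// mulr_gt0.
have [N hN] := ch' _ d0.
have := l2norm_point (km (phi N)).1 (ltW d0) (hN N (leqnn N)).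
rewrite h00 subr0 (matrix_operator_delta _ _ TA) /symbol_matrix /l addrAC subrr add0r.
have [_ _ hk] := hkm (phi N).
rewrite cabsM cabs_real ger0_norm ?invr_ge0 ?mulr_ge0 ?(ltW p0)// ler_pdivrMl ?mulr_gt0//.
rewrite (_ : 2 * pi * (eta / (4 * pi)) = eta / 2); last first.
  by move: (pi : R) (lt0r_neq0 p0) => q q0; field; rewrite q0.
by move=> h4; lra.
Qed.

End Main.

Theorem corollary4p10 (R : realType) (Lam : int -> R) (mu rho : R)
  (hLam : is_weight Lam mu) (hrho : 0 < rho <= 1 / mu)
  (sigma : int -> R -> R[i]) (hsigma : symbol_class Lam rho 0 sigma) :
  compact_operator_l2 (pseudo_diff sigma) <-> limsup_symbol sigma = 0%E.
Proof.
have us := symbol_class_uniformly_smooth hsigma.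
by split; [exact: vanishing_of_compact|exact: compact_of_vanishing].
Qed.
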